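(* Let $0<\alpha<1$, $\lambda>0$ and $t>0$. The probability density $f_{\alpha,\lambda}(x,t)$ of the tempered stable subordinator $D_{\alpha,\lambda}(t)$ is given by $$f_{\alpha,\lambda}(x,t)=e^{-\lambda x+t\lambda^{\alpha}}\sum_{k=0}^{\infty}\frac{(-1)^{k+1}}{\pi\,k!}\,\Gamma(1+k\alpha)\,x^{-(1+\alpha k)}\,t^{k}\sin(\pi\alpha k),\qquad x>0.$$
   Context: For $0<\alpha<1$ and $\lambda>0$, the tempered stable subordinator $(D_{\alpha,\lambda}(t))_{t\ge 0}$ with stability index $\alpha$ and tempering parameter $\lambda$ is the subordinator (non-decreasing Lévy process started at $0$) with Laplace transform $\mathbb{E}(e^{-sD_{\alpha,\lambda}(t)})=e^{-t((s+\lambda)^{\alpha}-\lambda^{\alpha})}$ for $s>0$. $\Gamma$ is the Gamma function. *)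

(* Defs.v *)
From HB Require Import structures.
From mathcomp Require Import all_boot all_order all_algebra.
From mathcomp Require Import all_classical all_reals all_analysis.

Set Implicit Arguments.
Unset Strict Implicit.
Unset Printing Implicit Defensive.

Import Order.TTheory GRing.Theory Num.Theory.
Import numFieldNormedType.Exports.

Local Open Scope classical_set_scope.
Local Open Scope ring_scope.

(* The Euler integral converges, and so gives the Gamma function, for 0 < z;
   this is the only range in which [Gamma] is meant to be used. *)
Definition Gamma {R : realType} (z : R) : R :=
  \int[lebesgue_measure]_(x in `]0, +oo[) (x `^ (z - 1) * expR (- x)).

(* The product rule for subfamilies is the case where some of the [B i] are
   [setT]. *)
Definition mutually_independent {d : measure_display} {T : measurableType d}
    {R : realType} (P : probability T R) (n : nat) (X : 'I_n -> T -> R) : Prop :=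
  forall B : 'I_n -> set R, (forall i, measurable (B i)) ->
    P (\bigcap_(i in [set: 'I_n]) (X i @^-1` B i)) =
    (\prod_(i < n) P (X i @^-1` B i))%E.

(* Processes are families of random variables indexed by [R] of which only
   the members with nonnegative index are relevant. *)
Section processes.
Context {d : measure_display} {T : measurableType d} {R : realType}.
Variable P : probability T R.
Implicit Type D : R -> {RV P >-> R}.

(* A finite list of times is represented by a sequence, of which only the
   first [n.+1] entries are used. *)
Definition independent_increments D : Prop :=
  forall (n : nat) (u : nat -> R), 0 <= u 0%N -> nondecreasing_seq u ->
    mutually_independent P
      (fun (i : 'I_n) (w : T) => D (u i.+1) w - D (u i) w).

Definition stationary_increments D : Prop :=
  forall s h : R, 0 <= s -> 0 <= h -> forall B : set R, measurable B ->
    P ((fun w => D (s + h) w - D s w) @^-1` B) = P (D h @^-1` B).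

Definition stochastically_continuous D : Prop :=
  forall t eps : R, 0 <= t -> 0 < eps ->
    P [set w | eps < `|D s w - D t w|]
      @[s --> within [set s | 0 <= s] (nbhs t)] --> 0%E.

Record levy_process D : Prop := {
  levy_start : {ae P, forall w, D 0 w = 0};
  levy_independent : independent_increments D;
  levy_stationary : stationary_increments D;
  levy_continuous : stochastically_continuous D }.

Record subordinator D : Prop := {
  subordinator_levy : levy_process D;
  subordinator_nondecreasing : {ae P, forall w,
    forall s t : R, 0 <= s -> s <= t -> D s w <= D t w} }.

Record tempered_stable_subordinator (alpha lambda : R) D : Prop := {
  tss_subordinator : subordinator D;
  tss_laplace : forall t s : R, 0 <= t -> 0 < s ->
    ('E_P[fun w => expR (- (s * D t w))] =
      (expR (- (t * ((s + lambda) `^ alpha - lambda `^ alpha))))%:E)%E }.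

Definition has_density (X : {RV P >-> R}) (f : R -> R) : Prop :=
  [/\ measurable_fun setT f,
      (forall x, 0 <= f x) &
      forall A : set R, measurable A ->
        distribution P X A = (\int[lebesgue_measure]_(x in A) (f x)%:E)%E].

End processes.

Definition tss_term {R : realType} (alpha x t : R) (k : nat) : R :=
  (-1) ^+ k.+1 / (pi * k`!%:R) * Gamma (1 + k%:R * alpha)
    * x `^ (- (1 + alpha * k%:R)) * t ^+ k * sin (pi * alpha * k%:R).

Definition tss_density {R : realType} (alpha lambda x t : R) : R :=
  if 0 < x then
    expR (- (lambda * x) + t * lambda `^ alpha)
      * limn (series (tss_term alpha x t))
  else 0.

(* Main.v *)
Require Import Defs.
From HB Require Import structures.
From mathcomp Require Import all_boot all_order all_algebra.
From mathcomp Require Import all_classical all_reals all_analysis.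
From mathcomp Require Import measurable_realfun.
From mathcomp Require Import ring lra.

(** The factor [e^(- lambda x + t lambda^alpha)] only shifts the Laplace variable
    by [lambda] and normalises. So the matter is the sum [h] of the series,
    which ought to be the density at time [t] of the stable subordinator
    without tempering: what has to be shown is that the series converges and
    that the Laplace transform of [h] is [e^(- t s^a)], with [a = alpha]. Then
    the law of [D t] has the same Laplace transform as the candidate density,
    and Laplace transforms determine laws.

    Inverting [e^(- t z^a)] along a contour around the negative half-axis
    suggests that [pi h(x)] is the integral along the ray of angle [pi] of
    [Im (e^(x z - t z^a) dz)]. Expanding [e^(- t z^a)] on this ray and
    integrating term by term produces Gamma integrals and exactly the series,
    and the domination by [e^(- x u + t u^a)], integrable because [a < 1],
    justifies this. Next the ray is turned from the angle [pi] to [pi / 2],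
    where [Re z^a > 0]: the integral becomes absolutely convergent uniformly
    in [x], so [h] extends to a bounded continuous function, [stable_wave] up
    to [pi] (lemma [cvg_tss_series]). By Fubini's theorem the Laplace transform
    of [h] at [s] is [1 / pi] times the integral of
    [Im (e^(- t z^a) / (s - z) dz)] along the imaginary half-axis
    (lemma [laplace_stable_wave]). Turning the ray further, towards the
    positive half-axis, the imaginary part of [dz / (s - z)] tends to [pi]
    times the Dirac mass at [s], as a Poisson kernel does, whence the value
    [e^(- t s^a)] (lemma [integral_ray_res_pihalf]). Both rotations are
    instances of [integral_rotate_ray], which is Cauchy's theorem on a
    sector, proved by differentiating in the angle under the integral sign.

    For the uniqueness, the function [exp (- c e^(- m X))] is a power series
    in [e^(- m X)], so that its expectation is determined by the Laplace
    transform; with [c = m e^(m r)] it tends to the indicator of [X > r] as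
    [m] tends to infinity. This gives the tails of [D t] in terms of the
    candidate density (lemma [laplace_tail_eq]) before this density is known
    to be nonnegative. Its nonnegativity follows, because tails are
    nonincreasing and [h] is continuous, and the tails determine the law
    (lemma [has_density_of_laplace]). *)

Set Implicit Arguments.
Unset Strict Implicit.
Unset Printing Implicit Defensive.

Import Order.TTheory GRing.Theory Num.Theory.
Import numFieldNormedType.Exports.

Local Open Scope classical_set_scope.
Local Open Scope ring_scope.

(** * Powers compared with lines and exponentials *)

Section bounds.
Context {R : realType}.
Implicit Types (a c e t x r : R).

Lemma powR_sublinear_near a t e : a < 1 -> 0 <= t -> 0 < e ->
  exists2 M : R, 0 < M & forall r, M <= r -> t * r `^ a <= e * r.
Proof.
move=> a1 t0 e0; pose b := 1 - a.
have b0 : 0 < b by rewrite subr_gt0.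
(* [t + 1] rather than [t] keeps the threshold positive when [t = 0]. *)
exists (((t + 1) / e) `^ b^-1).
  by rewrite powR_gt0// divr_gt0// ltr_wpDl.
move=> r Mr.
have r0 : 0 < r by rewrite (lt_le_trans _ Mr)// powR_gt0// divr_gt0// ltr_wpDl.
have te : t <= e * r `^ b.
  rewrite mulrC -ler_pdivrMr//; apply: (@le_trans _ _ ((t + 1) / e)).
    by rewrite ler_pM2r ?invr_gt0// lerDl.
  have q0 : 0 <= (t + 1) / e by rewrite divr_ge0// ?ltW// ltr_wpDl.
  move: Mr; set q := _ / e in q0 * => Mr.
  rewrite -[leLHS]powRr1// -(mulVf (lt0r_neq0 b0)) powRrM ge0_ler_powR ?nnegrE ?powR_ge0 ?(ltW b0)//.
  exact: ltW.
rewrite (le_trans (ler_wpM2r (powR_ge0 _ _) te))//.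
rewrite -mulrA -powRD; last by rewrite (gt_eqF r0) implybT.
by rewrite subrK powRr1// ltW.
Qed.

(** Since [a < 1], a power is beaten by any line of positive slope: this is
    what lets [e^(x z)] absorb [e^(- t z^a)] where the latter grows. *)
Lemma powR_le_affine a t e : 0 <= a -> a < 1 -> 0 <= t -> 0 < e ->
  exists K : R, forall r, 0 <= r -> t * r `^ a <= e * r + K.
Proof.
move=> a0 a1 t0 e0; have [M M0 HM] := powR_sublinear_near a1 t0 e0.
exists (t * M `^ a) => r r0; have [Mr|rM] := leP M r.
  by rewrite (le_trans (HM _ Mr))// lerDl mulr_ge0// powR_ge0.
apply: (@le_trans _ _ (t * M `^ a)); last by rewrite lerDr mulr_ge0// ltW.
by rewrite ler_wpM2l// ge0_ler_powR ?nnegrE// ltW.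
Qed.

(** One term of the exponential series at [c * r `^ a] is enough, namely one
    whose exponent [n.+1] satisfies [m <= n.+1 * a]. *)
Lemma expR_powR_decay (m : nat) a c : 0 < a -> 0 < c ->
  exists2 K : R, 0 < K & forall r, 0 <= r -> (1 + r) ^+ m * expR (- (c * r `^ a)) <= K.
Proof.
move=> a0 c0.
have [n mn] : exists n : nat, m%:R <= n.+1%:R * a.
  exists (Num.truncn (m%:R / a)); rewrite -ler_pdivrMr//.
  by rewrite ltW// truncnS_gt.
pose L : R := n.+1`!%:R / c ^+ n.+1.
have L0 : 0 < L by rewrite divr_gt0 ?exprn_gt0// ltr0n fact_gt0.
exists (2 ^+ m * (1 + L)); first by rewrite mulr_gt0 ?exprn_gt0// addr_gt0.
move=> r r0; have v0 : 0 <= c * r `^ a by rewrite mulr_ge0 ?powR_ge0 ?ltW.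
rewrite expRN ler_pdivrMr ?expR_gt0//.
have [r1|r1] := leP r 1.
  apply: (@le_trans _ _ (2 ^+ m)).
    by rewrite lerXn2r ?nnegrE ?addr_ge0// (natrD _ 1 1) lerD2l.
  rewrite -mulrA ler_peMr ?exprn_ge0//.
  rewrite -[leLHS]mulr1 ler_pM// ?lerDl ?(ltW L0)//.
  by rewrite -expR0 ler_expR.
apply: (@le_trans _ _ ((2 * r) ^+ m)).
  by rewrite lerXn2r ?nnegrE ?addr_ge0 ?mulr_ge0// mulr_natl mulr2n lerD2r ltW.
rewrite exprMn -mulrA ler_wpM2l ?exprn_ge0//.
apply: (@le_trans _ _ (L * expR (c * r `^ a))); last first.
  by rewrite ler_wpM2r ?expR_ge0// lerDr.
have := @expR_ge1Dxn R _ n v0; rewrite exprMn => h.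
have {}h : c ^+ n.+1 * (r `^ a) ^+ n.+1 / n.+1`!%:R <= expR (c * r `^ a).
  by rewrite (le_trans _ h)// lerDr.
rewrite /L mulrAC ler_pdivlMr ?exprn_gt0// mulrC.
rewrite [leRHS]mulrC -ler_pdivrMr ?ltr0n ?fact_gt0//.
rewrite (le_trans _ h)// ler_wpM2r// ler_wpM2l ?exprn_ge0 ?(ltW c0)//.
rewrite -[leLHS]powR_mulrn// -[leRHS]powR_mulrn ?powR_ge0// -powRrM.
by rewrite ler_powR ?(ltW r1)// mulrC.
Qed.

Lemma is_derive_powR a r : 0 < r -> is_derive r 1 (@powR R ^~ a) (a * r `^ a / r).
Proof.
move=> r0; have h := is_derive1_powR a r0; apply: is_derive_eq.
by rewrite powRB ?(lt0r_neq0 r0) ?implybT// powRr1 ?ltW// mulrA.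
Qed.

End bounds.

(** * Rotation of a ray of integration *)

Section rotation.
Context {R : realType}.
Notation mu := (@lebesgue_measure R).

Lemma cvgn0_le (f g : R ^nat) : (forall n, `|f n| <= g n) ->
  g n @[n --> \oo] --> 0 -> f n @[n --> \oo] --> 0.
Proof.
move=> fg g0; apply/cvgr0Pnorm_le => eps eps0.
near=> n; apply: (le_trans (fg n)); apply: (le_trans (ler_norm _)); near: n.
exact: cvgr0_norm_le.
Unshelve. all: end_near. Qed.

(** Powers with exponent below 1 fail to be differentiable at 0, so that
    calculus is done on compact intervals that stay away from 0 and exhaust
    the half line; [n.+2] makes each of them nondegenerate. *)
Lemma cvg_Rintegral_exhaust (f : R -> R) :
  mu.-integrable `]0, +oo[ (EFin \o f) ->
  \int[mu]_(r in `[n.+2%:R^-1, n.+2%:R]) f r @[n --> \oo]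
    --> \int[mu]_(r in `]0, +oo[) f r.
Proof.
move=> intf; have /integrableP[mf _] := intf.
pose I n := `[n.+2%:R^-1, n.+2%:R]%classic : set R.
have I0 n : I n `<=` `]0, +oo[.
  move=> r; rewrite /I/= !in_itv/= andbT => /andP[+ _].
  by apply: lt_le_trans; rewrite invr_gt0.
have -> : (fun n => \int[mu]_(r in I n) f r) =
    (fun n => \int[mu]_(r in `]0, +oo[) (f \_ (I n)) r).
  by apply/funext => n; rewrite -Rintegral_mkcondr setIidr.
apply: fine_cvg; rewrite fineK; last exact: integrable_fin_num.
apply: (@dominated_cvg _ _ _ mu _ _ _ _ (abse \o (EFin \o f))) => //.
- move=> n; apply/measurable_EFinP.
  apply: measurable_funTS; apply/(measurable_restrictT _ _).1.
    exact: measurable_itv.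
  apply: (measurable_funS _ (I0 n)); first exact: measurable_itv.
  exact/measurable_EFinP.
- move=> r; rewrite /= in_itv/= andbT => r0.
  apply: cvg_EFin; first exact: nearW.
  apply: cvg_near_cst.
  near=> n; rewrite /= patchE ifT// inE /I/= in_itv/=; apply/andP; split.
    rewrite -(invrK r) lef_pV2 ?posrE ?invr_gt0//.
    near: n; exists (Num.truncn r^-1) => // n /= hn.
    rewrite (le_trans (ltW (truncnS_gt _)))// ler_nat ltnS; exact: leqW.
  near: n; exists (Num.truncn r) => // n /= hn.
  rewrite (le_trans (ltW (truncnS_gt _)))// ler_nat ltnS; exact: leqW.
- exact: integrable_abse.
- move=> n r _ /=; rewrite patchE; case: ifP => _//.
  by rewrite normr0 lee_fin.
Unshelve. all: end_near. Qed.

Lemma continuous_itv_integrable (f : R -> R) (e M : R) : 0 < e ->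
  {in `]0, +oo[, continuous f} -> mu.-integrable `[e, M] (EFin \o f).
Proof.
move=> e0 cf; apply: continuous_compact_integrable; first exact: segment_compact.
apply: continuous_in_subspaceT => r; rewrite inE/= in_itv/= => /andP[er _].
by apply: cf; rewrite in_itv/= andbT (lt_le_trans e0).
Qed.

Lemma Rintegral_FTC_itv (f F : R -> R) (e M : R) : 0 < e -> e < M ->
  {in `]0, +oo[, continuous f} ->
  (forall x : R, 0 < x -> is_derive x 1 F (f x)) ->
  \int[mu]_(x in `[e, M]) f x = F M - F e.
Proof.
move=> e0 eM cf dF.
have dFr (x : R) : 0 < x -> derivable F x 1 by move=> /dF[].
rewrite /Rintegral (@continuous_FTC2 _ _ F)//.
- apply: continuous_in_subspaceT => r; rewrite inE/= in_itv/= => /andP[er _].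
  by apply: cf; rewrite in_itv/= andbT (lt_le_trans e0).
- split.
  + by move=> r; rewrite in_itv/= => /andP[er _]; apply: dFr; exact: lt_trans er.
  + apply: cvg_at_right_filter; apply: differentiable_continuous.
    exact/derivable1_diffP/dFr.
  + apply: cvg_at_left_filter; apply: differentiable_continuous.
    by apply/derivable1_diffP/dFr; exact: lt_trans eM.
- move=> r; rewrite in_itv/= => /andP[er _]; rewrite derive1E.
  by have [_ ->] := dF _ (lt_trans e0 er).
Qed.

Lemma ltr_inv_nat2 n : (n.+2%:R^-1 : R) < n.+2%:R.
Proof. by rewrite (@lt_trans _ _ 1)// ?invf_lt1// (ltr_nat _ 1). Qed.

Lemma Rintegral_FTC0y (f F : R -> R) (A B : R) :
  {in `]0, +oo[, continuous f} ->
  (forall x : R, 0 < x -> is_derive x 1 F (f x)) ->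
  mu.-integrable `]0, +oo[ (EFin \o f) ->
  F n.+2%:R^-1 @[n --> \oo] --> A -> F n.+2%:R @[n --> \oo] --> B ->
  \int[mu]_(x in `]0, +oo[) f x = B - A.
Proof.
move=> cf dF intf FA FB; have h := cvg_Rintegral_exhaust intf.
have h' : \int[mu]_(r in `[n.+2%:R^-1, n.+2%:R]) f r @[n --> \oo] --> B - A.
  rewrite (_ : (fun n => _) = (fun n => F n.+2%:R - F n.+2%:R^-1)); first exact: cvgB.
  by apply/funext => n; apply: Rintegral_FTC_itv => //; exact: ltr_inv_nat2.
by rewrite -(cvg_lim (@Rhausdorff R) h) (cvg_lim (@Rhausdorff R) h').
Qed.

(** Cauchy's theorem for a sector, with real functions only. For a holomorphic
    [g] and [z = r e^(i th)], the functions [A = Im (e^(i th) g(z))] and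
    [B = Re (z g(z))] have [dA/dth = dB/dr], by the Cauchy-Riemann equations
    in polar coordinates; [C] is this common derivative. Hence the
    derivative in [th] of the integral of [A] over [[e, M]] consists of the
    two boundary terms [B M th - B e th], the contributions of the arcs, and
    these are negligible as soon as [B] is bounded, uniformly in [th], by a
    function [b] that vanishes at 0 and at infinity. *)
Lemma integral_rotate_ray (A B C : R -> R -> R) (u v th0 th1 : R)
    (b : R -> R) :
  u < th0 -> th0 <= th1 -> th1 < v ->
  (forall r th : R, 0 < r -> u < th < v -> is_derive th 1 (A r) (C r th)) ->
  (forall r th : R, 0 < r -> u < th < v -> is_derive r 1 (B ^~ th) (C r th)) ->
  (forall th : R, u < th < v -> {in `]0, +oo[, continuous (A ^~ th)}) ->
  (forall th : R, u < th < v -> {in `]0, +oo[, continuous (C ^~ th)}) ->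
  (forall e M : R, 0 < e -> exists K : R, forall r th : R, e <= r <= M -> u < th < v ->
    `|C r th| <= K) ->
  (forall r th : R, 0 < r -> th0 <= th <= th1 -> `|B r th| <= b r) ->
  b n.+2%:R^-1 @[n --> \oo] --> 0 -> b n.+2%:R @[n --> \oo] --> 0 ->
  mu.-integrable `]0, +oo[ (EFin \o A ^~ th0) ->
  mu.-integrable `]0, +oo[ (EFin \o A ^~ th1) ->
  \int[mu]_(r in `]0, +oo[) A r th0 = \int[mu]_(r in `]0, +oo[) A r th1.
Proof.
move=> uth0 th01 th1v dA dB cA cC bC Bb b00 b10 iA0 iA1.
pose e n : R := n.+2%:R^-1; pose M n : R := n.+2%:R.
have e0 n : 0 < e n by rewrite invr_gt0.
have eM n : e n < M n := ltr_inv_nat2 n.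
pose Phi n th := \int[mu]_(r in `[e n, M n]) A r th.
have dPhi n th : u < th < v -> is_derive th 1 (Phi n) (B (M n) th - B (e n) th).
  move=> thuv.
  have [K HK] := bC (e n) (M n) (e0 n).
  have K0 : 0 <= K.
    by rewrite (le_trans (normr_ge0 (C (e n) th)))// HK// lexx ltW.
  have intA x : `]u, v[%classic x -> mu.-integrable `[e n, M n] (EFin \o (A ^~ x)).
    by rewrite /= in_itv/= => xuv; apply: continuous_itv_integrable => //; exact: cA.
  have rpos y : `[e n, M n]%classic y -> 0 < y.
    by rewrite /= in_itv/= => /andP[+ _]; exact: lt_le_trans.
  have derA x y : `]u, v[%classic x -> `[e n, M n]%classic y ->
      derivable (A y) x 1.
    rewrite /= in_itv/= => xuv /rpos y0.
    by have [] := dA _ _ y0 xuv.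
  have d1A x y : `]u, v[%classic x -> `[e n, M n]%classic y ->
      partial1of2 (fun x y => A y x) x y = C y x.
    rewrite /= in_itv/= => xuv /rpos y0.
    by rewrite partial1of2E; have [_ ->] := dA _ _ y0 xuv.
  have thI : `]u, v[%classic th by rewrite /= in_itv.
  have intK : mu.-integrable `[e n, M n] (EFin \o cst K).
    by apply: continuous_itv_integrable => // x _; exact: cst_continuous.
  have ubK x y : `]u, v[%classic x -> `[e n, M n]%classic y ->
      `|partial1of2 (fun x y => A y x) x y| <= cst K y.
    by move=> Ix Iy; rewrite d1A//; apply: HK => //; move: Ix Iy; rewrite /= !in_itv.
  have mI : measurable (`[e n, M n]%classic : set (measurableTypeR R)) by [].
  have dv := @derivable_under_integral R _ _ mu (fun x y => A y x) _ mI th u v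
    thI intA derA _ (fun=> K0) intK ubK.
  have dE := @differentiation_under_integral R _ _ mu (fun x y => A y x) _ mI th
    u v thI intA derA _ (fun=> K0) intK ubK.
  apply: DeriveDef; first exact: dv.
  rewrite -derive1E [LHS]dE.
  have -> : \int[mu]_(y in `[e n, M n]) partial1of2 (fun x y => A y x) th y =
      \int[mu]_(y in `[e n, M n]) C y th.
    by apply: eq_Rintegral => y /[!inE] Iy; rewrite d1A.
  exact: (Rintegral_FTC_itv (e0 n) (eM n) (cC _ thuv) (fun r r0 => dB r th r0 thuv)).
(* The mean value theorem replaces the integration along the arcs. *)
have Phi_le n : `|Phi n th1 - Phi n th0| <= (b (e n) + b (M n)) * (th1 - th0).
  have [||c /[!in_itv]/= cth ->] := @MVT_segment R (Phi n)
      (fun th => B (M n) th - B (e n) th) th0 th1 th01.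
  - move=> x; rewrite in_itv/= => /andP[th0x xth1]; apply: dPhi.
    by rewrite (lt_trans uth0)//= (lt_trans xth1).
  - apply: derivable_within_continuous => x; rewrite in_itv/= => /andP[th0x xth1].
    have xuv : u < x < v by rewrite (lt_le_trans uth0)//= (le_lt_trans xth1).
    by have [] := dPhi n _ xuv.
  rewrite normrM [X in _ * X]ger0_norm ?subr_ge0//.
  rewrite ler_wpM2r ?subr_ge0// [b (e n) + _]addrC (le_trans (ler_normB _ _))//.
  by rewrite lerD// ?Bb//; exact: lt_trans (eM n).
have lim_diff : (fun n => Phi n th1 - Phi n th0) @ \oo --> 0.
  apply: (cvgn0_le Phi_le).
  by rewrite -[X in _ --> X](mul0r (th1 - th0)) -[X in X * _](addr0 0);
    apply: cvgMl; apply: cvgD.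
have lim_diff' : (fun n => Phi n th1 - Phi n th0) @ \oo -->
    \int[mu]_(r in `]0, +oo[) A r th1 - \int[mu]_(r in `]0, +oo[) A r th0.
  by apply: cvgB; exact: cvg_Rintegral_exhaust.
apply/esym/eqP; rewrite -subr_eq0; apply/eqP.
by rewrite -(cvg_lim (@Rhausdorff R) lim_diff') (cvg_lim (@Rhausdorff R) lim_diff).
Qed.

End rotation.

(** * Integrability on the half line *)

Section decay.
Context {R : realType}.
Notation mu := (@lebesgue_measure R).

Lemma derivable_in_continuous (f : R -> R) :
  (forall r, 0 < r -> derivable f r 1) -> {in `]0, +oo[, continuous f}.
Proof.
move=> df r; rewrite in_itv/= andbT => r0.
exact/differentiable_continuous/derivable1_diffP/df.
Qed.

Lemma continuous_measurable_halfline (f : R -> R) :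
  {in `]0, +oo[, continuous f} -> measurable_fun (`]0, +oo[%classic : set R) f.
Proof.
by move=> cf; apply: open_continuous_measurable_fun => // r /[!inE]; exact: cf.
Qed.

Lemma integrable_oneDsqrV : mu.-integrable `]0, +oo[ (fun r => (oneDsqr r)^-1%:E).
Proof.
apply: (@integrableS _ _ _ mu `[0, +oo[%classic) => //.
  by move=> r /=; rewrite !in_itv/= !andbT; exact: ltW.
apply/integrableP; split.
  apply/measurable_EFinP; apply: measurable_funTS.
  have := @continuous_oneDsqrV R; exact: continuous_measurable_fun.
rewrite (_ : integral _ _ _ = (pi / 2)%:E) ?ltry// -integral0y_oneDsqr.
by apply: eq_integral => r _; rewrite gee0_abs// lee_fin invr_ge0//.
Qed.

Lemma integrable_le_oneDsqrV (f : R -> R) (K : R) :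
  measurable_fun (`]0, +oo[%classic : set R) f ->
  (forall r, 0 < r -> `|f r| <= K / oneDsqr r) ->
  mu.-integrable `]0, +oo[ (EFin \o f).
Proof.
move=> mf fK.
apply: (le_integrable _ _ _ (integrableZl _ K integrable_oneDsqrV)) => //.
  exact/measurable_EFinP.
move=> r /=; rewrite in_itv/= andbT => r0.
by rewrite lee_fin (le_trans (fK _ r0))// ler_norm.
Qed.

Variables a c : R.
Hypotheses (a0 : 0 < a) (c0 : 0 < c).

Lemma expR_powR_le_oneDsqrV :
  exists2 K : R, 0 < K & forall r, 0 <= r -> expR (- (c * r `^ a)) <= K / oneDsqr r.
Proof.
have [K K0 HK] := expR_powR_decay 2 a0 c0.
exists K => // r r0; rewrite ler_pdivlMr; last by rewrite (lt_le_trans ltr01 (oneDsqr_ge1 r)).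
rewrite (le_trans _ (HK _ r0))// mulrC ler_wpM2r ?expR_ge0//.
by rewrite /oneDsqr sqrrD expr1n mul1r lerD2r lerDl mulrn_wge0.
Qed.

Lemma integrable_le_expR_powR (f : R -> R) (K : R) :
  measurable_fun (`]0, +oo[%classic : set R) f ->
  (forall r, 0 < r -> `|f r| <= K * expR (- (c * r `^ a))) ->
  mu.-integrable `]0, +oo[ (EFin \o f).
Proof.
move=> mf fK; have [L L0 HL] := expR_powR_le_oneDsqrV.
have K0 : 0 <= K.
  rewrite -(pmulr_lge0 _ (expR_gt0 (- (c * 1 `^ a)))).
  exact: le_trans (fK _ ltr01).
apply: (@integrable_le_oneDsqrV _ (K * L)) => // r r0.
by rewrite (le_trans (fK _ r0))// -mulrA ler_wpM2l// HL// ltW.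
Qed.

Lemma integrable_expR_powR (K : R) :
  mu.-integrable `]0, +oo[ (fun r => (K * expR (- (c * r `^ a)))%:E).
Proof.
apply: (@integrable_le_expR_powR _ `|K|) => [|r r0].
  apply: continuous_measurable_halfline; apply: derivable_in_continuous => r r0.
  by have h := is_derive_powR a r0; apply: ex_derive.
by rewrite normrM [X in _ * X]ger0_norm ?expR_ge0.
Qed.

(** The function [r * e^(- c r^a)] dominates the contributions of the arcs in
    the rotations below; it is negligible at 0 because of the factor [r], and
    at infinity because of the exponential. *)
Lemma cvg_mul_expR_powR0 (K : R) :
  K * (n.+2%:R^-1 * expR (- (c * n.+2%:R^-1 `^ a))) @[n --> \oo] --> 0.
Proof.
rewrite -[X in _ --> X](mulr0 K); apply: cvgMr.
apply: (@cvgn0_le _ _ (fun n => n.+1%:R^-1)) => [n|]; last exact: cvg_harmonic.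
  rewrite ger0_norm ?mulr_ge0 ?expR_ge0//.
  rewrite (@le_trans _ _ n.+2%:R^-1)//.
    rewrite ler_piMr// -[leRHS]expR0 ler_expR oppr_le0.
    by rewrite mulr_ge0 ?powR_ge0 ?ltW.
  by rewrite lef_pV2 ?posrE// ler_nat.
Qed.

Lemma cvg_mul_expR_powRy (K : R) :
  K * (n.+2%:R * expR (- (c * n.+2%:R `^ a))) @[n --> \oo] --> 0.
Proof.
rewrite -[X in _ --> X](mulr0 K); apply: cvgMr.
have [L L0 HL] := expR_powR_decay 2 a0 c0.
apply: (@cvgn0_le _ _ (fun n => L * n.+1%:R^-1)) => [n|].
  rewrite ger0_norm ?mulr_ge0 ?expR_ge0//.
  rewrite ler_pdivlMr ?ltr0n// mulrAC (le_trans _ (HL n.+2%:R _))//.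
  rewrite ler_wpM2r ?expR_ge0// expr2 ler_pM//.
    by rewrite lerDr.
  by rewrite -(natrD _ 1) ler_nat leqW.
by rewrite -[X in _ --> X](mulr0 L); apply: cvgMr; exact: cvg_harmonic.
Qed.

End decay.

(** * The exponential of the stable exponent along a ray *)

Section stable_ray.
Context {R : realType}.
Notation mu := (@lebesgue_measure R).
Variables a t : R.
Hypotheses (a0 : 0 < a) (a1 : a < 1) (t0 : 0 < t).

(* The rate of decay of [e^(- t z^a)] along the imaginary axis: there
   [Re z^a = r^a * cos (a * pi / 2)]. *)
Local Notation kappa := (t * cos (a * (pi / 2))).

Lemma sin_mull_le (eta : R) : 0 <= eta <= pi / 2 -> sin (a * eta) <= sin eta.
Proof.
move=> /andP[eta0 eta1]; have pi0 := @pi_gt0 R; move: (a0) (a1) => ga ga1.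
have : a * eta <= eta by rewrite ler_piMl// ltW.
rewrite le_eqVlt => /predU1P[->//|aeta_lt].
have aeta0 : 0 <= a * eta by rewrite mulr_ge0// ltW.
by rewrite ltW// ltr_sin// in_itv/=; apply/andP; split; lra.
Qed.

Lemma kappa_gt0 : 0 < kappa.
Proof.
rewrite mulr_gt0// cos_gt0_pihalf//; have := @pi_gt0 R; move: a0 a1 => *.
by apply/andP; split; nra.
Qed.

Section exponential_ray.
Variable x : R.

(* With [z = r e^(i th)], the complex number [e^(i th) e^(x z - t z^a)] has
   modulus [expR (E r th)] and argument [F r th]. *)
Let E (r th : R) : R := x * r * cos th - t * r `^ a * cos (a * th).
Let F (r th : R) : R := th + x * r * sin th - t * r `^ a * sin (a * th).

(** The imaginary part of [e^(i th) e^(x z - t z^a)] at [z = r e^(i th)]. *)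
Definition ray_exp_im (r th : R) : R := expR (E r th) * sin (F r th).

(** The real part of [z e^(x z - t z^a)], whose radial derivative is the
    angular derivative of [ray_exp_im]. *)
Definition ray_exp_prim (r th : R) : R := r * (expR (E r th) * cos (F r th)).
Let Et (r th : R) : R := - x * r * sin th + a * t * r `^ a * sin (a * th).
Let Ft (r th : R) : R := 1 + x * r * cos th - a * t * r `^ a * cos (a * th).
Definition ray_exp_der (r th : R) : R :=
  expR (E r th) * (Et r th * sin (F r th) + Ft r th * cos (F r th)).

Lemma is_derive_ray_exp_im (r th : R) : is_derive th 1 (ray_exp_im r) (ray_exp_der r th).
Proof.
apply: is_derive_eq; rewrite /ray_exp_der /Et /Ft /GRing.scale/=; ring.
Qed.

Lemma is_derive_ray_exp_prim (r th : R) : 0 < r ->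
  is_derive r 1 (ray_exp_prim ^~ th) (ray_exp_der r th).
Proof.
move=> r0; have h := is_derive_powR a r0; apply: is_derive_eq.
rewrite /ray_exp_der /Et /Ft /GRing.scale/=; field; exact: lt0r_neq0.
Qed.

Lemma derivable_ray_exp_im (r th : R) : 0 < r -> derivable (ray_exp_im ^~ th) r 1.
Proof. by move=> r0; have h := is_derive_powR a r0; apply: ex_derive. Qed.

Lemma derivable_ray_exp_der (r th : R) : 0 < r -> derivable (ray_exp_der ^~ th) r 1.
Proof. by move=> r0; have h := is_derive_powR a r0; apply: ex_derive. Qed.

Lemma ray_exp_der_bound (r th M : R) : 0 <= x -> 0 <= r <= M ->
  `|ray_exp_der r th| <= expR (x * M + t * M `^ a) *
    (1 + 2 * (x * M) + 2 * (t * M `^ a)).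
Proof.
move=> x0 /andP[r0 rM]; have M0 := le_trans r0 rM.
have raM : r `^ a <= M `^ a by rewrite ge0_ler_powR ?nnegrE// ltW.
have ra0 : 0 <= r `^ a := powR_ge0 _ _.
have xr : x * r <= x * M by rewrite ler_wpM2l.
have tr : t * r `^ a <= t * M `^ a by rewrite ler_wpM2l// ltW.
have xr0 : 0 <= x * r by rewrite mulr_ge0.
have tr0 : 0 <= t * r `^ a by rewrite mulr_ge0// ltW.
have bnd (p q z w : R) : 0 <= p -> 0 <= q -> `|z| <= 1 -> `|w| <= 1 ->
    `|p * z + q * w| <= p + q.
  move=> p0 q0 z1 w1; rewrite (le_trans (ler_normD _ _))// !normrM.
  by rewrite !(ger0_norm p0, ger0_norm q0) lerD// ler_piMr.
have atr : a * t * r `^ a <= t * M `^ a.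
  by rewrite -mulrA (le_trans _ tr)// ler_piMl// ltW.
have atr0 : 0 <= a * t * r `^ a by rewrite -mulrA mulr_ge0// ltW.
rewrite /ray_exp_der normrM (ger0_norm (expR_ge0 _)) ler_pM ?expR_ge0//.
  rewrite ler_expR /E (le_trans (ler_norm _))// -mulrN.
  rewrite (le_trans (bnd _ _ _ _ _ _ _ _))// ?normrN ?cos_max//.
  exact: lerD.
have -> : 1 + 2 * (x * M) + 2 * (t * M `^ a) =
    (x * M + t * M `^ a) + (1 + (x * M + t * M `^ a)) by ring.
rewrite (le_trans (ler_normD _ _))// lerD// normrM.
  rewrite -[leRHS]mulr1 ler_pM ?sin_max// /Et.
  have -> : - x * r * sin th = (x * r) * - sin th by ring.
  by rewrite (le_trans (bnd _ _ _ _ _ _ _ _))// ?normrN ?sin_max// lerD.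
rewrite -[leRHS]mulr1 ler_pM ?cos_max// /Ft -addrA.
rewrite (le_trans (ler_normD _ _))// normr1 lerD2l -mulrN.
by rewrite (le_trans (bnd _ _ _ _ _ _ _ _))// ?normrN ?cos_max// lerD.
Qed.

Hypothesis x0 : 0 < x.

(** At [th = pi / 2 + eta] the exponent is
    [- x r sin eta - t r^a cos (a pi / 2 + a eta)]. As
    [sin (a eta) <= sin eta], the cosine is at least
    [cos (a pi / 2) - 2 sin eta], and the loss [2 t r^a sin eta] is made up
    for by [x r sin eta], up to a constant, because [a < 1]. *)
Lemma ray_exp_exponent_le : exists K : R, forall r th : R,
  0 <= r -> pi / 2 <= th <= pi -> E r th <= - (kappa * r `^ a) + K.
Proof.
have t20 : 0 <= 2 * t by rewrite mulr_ge0// ltW.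
have [K HK] := powR_le_affine (ltW a0) a1 t20 x0.
exists K => r th r0 /andP[th1 th2].
have K0 : 0 <= K.
  have := HK 0 (lexx 0); rewrite mulr0 add0r; apply: le_trans.
  by rewrite mulr_ge0// powR_ge0.
have := HK r r0; set v := r `^ a => {}HK.
have v0 : 0 <= v := powR_ge0 _ _.
pose eta := th - pi / 2; pose p := a * (pi / 2).
have pi0 := @pi_gt0 R; move: (a0) (a1) => ga ga1.
have eta0 : 0 <= eta <= pi / 2 by rewrite /eta; apply/andP; split; lra.
have aeta : 0 <= a * eta <= pi / 2 by rewrite /eta in eta0 *; apply/andP; split; nra.
have thE : th = eta + pi / 2 by rewrite /eta; ring.
have pE : a * th = p + a * eta by rewrite /p thE; ring.
rewrite /E pE {1}thE cosDpihalf cosD.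
have sle : sin (a * eta) <= sin eta := sin_mull_le eta0.
have s0 : 0 <= sin (a * eta).
  by apply: sin_ge0_pi; case/andP: aeta => *; apply/andP; split; lra.
have c0 : 0 <= cos (a * eta).
  by apply: cos_ge0_pihalf; case/andP: aeta => *; apply/andP; split; lra.
(* On the first quadrant the sum of the cosine and the sine is at least 1. *)
have c1 : 1 - sin (a * eta) <= cos (a * eta).
  have := cos2Dsin2 (a * eta); have := sin_le1 (a * eta); have := cos_le1 (a * eta).
  by move: s0 c0; move: (sin _) (cos _) => s c; nra.
have k0 : 0 <= cos p.
  by apply: cos_ge0_pihalf; rewrite /p; apply/andP; split; nra.
have k1 : cos p <= 1 := cos_le1 _.
have q1 : sin p <= 1 := sin_le1 _.
have S1 : sin eta <= 1 := sin_le1 _.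
have cosle : cos p - 2 * sin eta <= cos p * cos (a * eta) - sin p * sin (a * eta).
  have : cos p * (1 - sin (a * eta)) <= cos p * cos (a * eta) by rewrite ler_wpM2l.
  have : cos p * sin (a * eta) <= sin (a * eta) by rewrite ler_piMl.
  have : sin p * sin (a * eta) <= sin (a * eta) by rewrite ler_piMl.
  lra.
have tv : t * v * (cos p - 2 * sin eta) <=
    t * v * (cos p * cos (a * eta) - sin p * sin (a * eta)).
  by rewrite ler_wpM2l// mulr_ge0// ltW.
have S0 : 0 <= sin eta := le_trans s0 sle.
have : sin eta * (2 * t * v - x * r) <= sin eta * K by rewrite ler_wpM2l//; lra.
have : sin eta * K <= K by rewrite ler_piMl.
move: tv; set w := cos p * _ - _; rewrite -/p -/v.
lra.
Qed.

Lemma continuous_ray_exp_im (th : R) : {in `]0, +oo[, continuous (ray_exp_im ^~ th)}.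
Proof. by apply: derivable_in_continuous => r r0; exact: derivable_ray_exp_im. Qed.

Lemma ray_exp_im_le : exists K : R, forall r th : R,
  0 < r -> pi / 2 <= th <= pi -> `|ray_exp_im r th| <= K * expR (- (kappa * r `^ a)).
Proof.
have [K HK] := ray_exp_exponent_le; exists (expR K) => r th r0 thI.
rewrite normrM (ger0_norm (expR_ge0 _)) -[leRHS]mulr1 ler_pM ?expR_ge0 ?sin_max//.
by rewrite -expRD ler_expR addrC HK// ltW.
Qed.

Lemma integrable_ray_exp_im (th : R) : pi / 2 <= th <= pi ->
  mu.-integrable `]0, +oo[ (EFin \o (ray_exp_im ^~ th)).
Proof.
move=> thI; have [K HK] := ray_exp_im_le.
apply: (integrable_le_expR_powR a0 kappa_gt0 (K := K)) => [|r r0].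
  by apply: continuous_measurable_halfline; exact: continuous_ray_exp_im.
exact: HK.
Qed.

(** The series produces the integral along the negative half-axis, where the
    decay may be due to [e^(x z)] alone; along the imaginary half-axis
    [e^(- t z^a)] decays, hence the integrand does so uniformly in [x]. *)
Lemma integral_ray_exp_im :
  \int[mu]_(r in `]0, +oo[) ray_exp_im r (pi / 2) =
  \int[mu]_(r in `]0, +oo[) ray_exp_im r pi.
Proof.
have pi0 := @pi_gt0 R.
have [K HK] := ray_exp_exponent_le.
apply: (@integral_rotate_ray _ ray_exp_im ray_exp_prim ray_exp_der 0 (pi + 1) _ _
  (fun r => expR K * (r * expR (- (kappa * r `^ a))))).
- by lra.
- by lra.
- by lra.
- by move=> *; exact: is_derive_ray_exp_im.
- by move=> *; exact: is_derive_ray_exp_prim.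
- by move=> *; exact: continuous_ray_exp_im.
- by move=> *; apply: derivable_in_continuous => r r0; exact: derivable_ray_exp_der.
- move=> e M e0.
  exists (expR (x * M + t * M `^ a) * (1 + 2 * (x * M) + 2 * (t * M `^ a))).
  move=> r th /andP[er rM] _; apply: ray_exp_der_bound; first exact: ltW.
  by rewrite (le_trans (ltW e0)).
- move=> r th r0 thI; rewrite normrM (gtr0_norm r0) mulrCA ler_wpM2l ?(ltW r0)//.
  rewrite normrM (ger0_norm (expR_ge0 _)) -[leRHS]mulr1 ler_pM ?expR_ge0 ?cos_max//.
  by rewrite -expRD ler_expR addrC HK// ltW.
- exact: cvg_mul_expR_powR0 kappa_gt0 _.
- exact: cvg_mul_expR_powRy a0 kappa_gt0 _.
- by apply: integrable_ray_exp_im; lra.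
- by apply: integrable_ray_exp_im; lra.
Qed.

End exponential_ray.
End stable_ray.

(** * The Poisson kernel as an approximate identity *)

Section poisson_limit.
Context {R : realType}.
Notation mu := (@lebesgue_measure R).

Lemma integralT_oneDsqr : (\int[mu]_x ((oneDsqr x)^-1)%:E = pi%:E)%E.
Proof.
rewrite ge0_symfun_integralT.
- by rewrite -set_itvcy integral0y_oneDsqr -EFinM; congr EFin; field.
- by move=> x; rewrite invr_ge0// (le_trans ler01 (oneDsqr_ge1 x)).
- exact: continuous_oneDsqrV.
- by move=> x /=; rewrite /oneDsqr sqrrN.
Qed.

Lemma integrableT_oneDsqr : mu.-integrable setT (fun x => ((oneDsqr x)^-1)%:E).
Proof.
apply/integrableP; split.
  apply/measurable_EFinP.
  have := @continuous_oneDsqrV R; exact: continuous_measurable_fun.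
rewrite (_ : integral _ _ _ = pi%:E) ?ltry// -integralT_oneDsqr.
by apply: eq_integral => r _; rewrite gee0_abs// lee_fin invr_ge0.
Qed.

Lemma continuous_poisson_kernel (A b : R) : 0 < b ->
  continuous (fun r : R => b / ((r - A) ^+ 2 + b ^+ 2)).
Proof.
move=> b0 r; apply: differentiable_continuous; apply/derivable1_diffP.
have n0 : (r - A) ^+ 2 + b ^+ 2 != 0.
  by rewrite lt0r_neq0// ltr_wpDl ?sqr_ge0// exprn_gt0.
exact: derivableM.
Qed.

(** The substitution [r = A + b v], which turns the Poisson kernel of height
    [b] centred at [A] into [1 / (1 + v^2)]. *)
Lemma integral_poisson_affine (A b : R) (g : R -> R) : 0 < b ->
  {within `[0, +oo[, continuous g} -> (forall x, 0 <= x -> 0 <= g x) ->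
  (\int[mu]_(r in `[0%R, +oo[) (b / ((r - A) ^+ 2 + b ^+ 2) * g r)%:E =
   \int[mu]_(v in `[(- (A / b))%R, +oo[) (g (A + b * v) / oneDsqr v)%:E)%E.
Proof.
move=> b0 cg g0; pose F (v : R) := A + b * v.
have F0 : F (- (A / b)) = 0 by rewrite /F; field; exact: lt0r_neq0.
have dF (v : R) : is_derive v 1 F b.
  by apply: is_derive_eq; rewrite /GRing.scale/=; ring.
have F'E : F^`()%classic = cst b.
  by apply/funext => v; rewrite derive1E; have [_ ->] := dF v.
have cP := @continuous_poisson_kernel A b b0.
have P0 (r : R) : 0 <= b / ((r - A) ^+ 2 + b ^+ 2).
  by rewrite divr_ge0 ?(ltW b0)// addr_ge0 ?sqr_ge0.
have := @increasing_ge0_integration_by_substitutiony _ F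
  (fun r => b / ((r - A) ^+ 2 + b ^+ 2) * g r) (- (A / b)).
rewrite F0 => -> //.
- apply: eq_integral => v _; congr EFin; rewrite F'E !fctE /= /F /oneDsqr; field.
  apply/andP; split; apply: lt0r_neq0.
    by rewrite ltr_pwDl// sqr_ge0.
  have -> : (A + b * v - A) ^+ 2 + b ^+ 2 = b ^+ 2 * (v ^+ 2 + 1) by ring.
  by rewrite mulr_gt0 ?exprn_gt0// ltr_wpDl ?sqr_ge0.
- by move=> x y _ _ xy; rewrite /F ltrD2l ltr_pM2l.
- by rewrite F'E => x _; exact: cst_continuous.
- by rewrite F'E; exact: is_cvg_cst.
- by rewrite F'E; exact: is_cvg_cst.
- split; first by move=> x _; have [] := dF x.
  apply: cvg_at_right_filter; apply: differentiable_continuous.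
  by apply/derivable1_diffP; have [] := dF (- (A / b)).
- apply/cvgryPge => y; near=> x; rewrite /F -lerBlDl -ler_pdivrMl//.
- move: cg => /continuous_within_itvcyP[cg cg0]; apply/continuous_within_itvcyP; split.
    by move=> x x0; apply: cvgM; [exact: cP|exact: cg].
  by apply: cvgM => //; apply: cvg_at_right_filter; exact: cP.
- by move=> x; rewrite in_itv/= andbT => x0; rewrite mulr_ge0// g0// ltW.
Unshelve. all: end_near. Qed.

Lemma integrable_poisson_kernel (A b : R) : 0 < b ->
  mu.-integrable `]0, +oo[ (fun r => (b / ((r - A) ^+ 2 + b ^+ 2))%:E).
Proof.
move=> b0; have cP := @continuous_poisson_kernel A b b0.
have mP : measurable_fun setT (fun r : R => b / ((r - A) ^+ 2 + b ^+ 2)).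
  exact: continuous_measurable_fun.
apply/integrableP; split; first by apply/measurable_EFinP/measurable_funTS.
under eq_integral do rewrite /= ger0_norm ?divr_ge0 ?addr_ge0 ?sqr_ge0 ?(ltW b0)//.
rewrite integral_itv_obnd_cbnd; last exact/measurable_EFinP/measurable_funTS.
under eq_integral do rewrite -[X in X%:E]mulr1.
rewrite (@integral_poisson_affine A b (cst 1))//; last first.
  by apply: continuous_subspaceT => x; exact: cst_continuous.
apply: (@le_lt_trans _ _ pi%:E); last exact: ltry.
rewrite -integralT_oneDsqr; under eq_integral do rewrite mul1r.
apply: ge0_subset_integral; [exact: measurable_itv|by []| | |by []].
  apply/measurable_EFinP; have := @continuous_oneDsqrV R.
  exact: continuous_measurable_fun.
by move=> x _; rewrite lee_fin invr_ge0.
Qed.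

Lemma normr_sin_le (x : R) : `|sin x| <= `|x|.
Proof.
wlog x0 : x / 0 <= x => [H|].
  have [|x0] := leP 0 x; first exact: H.
  by rewrite -normrN -sinN -[leRHS]normrN H// oppr_ge0 ltW.
have [|c _] := @MVT_segment R sin cos 0 x x0.
  by apply: continuous_subspaceT => y; exact: continuous_sin.
by rewrite sin0 !subr0 => ->; rewrite normrM ler_piMl// cos_max.
Qed.

(** The Poisson kernels are an approximate identity of mass [pi]. After the
    substitution [r = A n + b n * v] the kernel no longer depends on [n], the
    half line becomes a half line that grows to the whole line since
    [s > 0], and dominated convergence applies. The functions [g n] may vary
    with [n]: all that matters is their behaviour along sequences that tend
    to [s]. *)
Lemma cvg_poisson_integral (A b : R ^nat) (g : nat -> R -> R) (s l M : R) :
  (forall n, 0 < b n) -> A @ \oo --> s -> b @ \oo --> 0 -> 0 < s ->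
  (forall n, {within `[0, +oo[, continuous (g n)}) ->
  (forall n x, 0 <= x -> 0 <= g n x <= M) ->
  (forall x_ : R ^nat, x_ @ \oo --> s -> g n (x_ n) @[n --> \oo] --> l) ->
  \int[mu]_(r in `]0, +oo[) (b n / ((r - A n) ^+ 2 + b n ^+ 2) * g n r)
    @[n --> \oo] --> l * pi.
Proof.
move=> b0 As b00 s0 cg gM gl.
have g0 n x : 0 <= x -> 0 <= g n x by move=> /(gM n)/andP[].
have M0 : 0 <= M by have /andP[] := gM 0%N 0 (lexx _); exact: le_trans.
pose J n : set R := `[(- (A n / b n)), +oo[%classic.
pose h n v := ((fun v => g n (A n + b n * v) / oneDsqr v) \_ (J n)) v.
have JE n v : J n v <-> 0 <= A n + b n * v.
  rewrite /J/= in_itv/= andbT -mulNr ler_pdivrMr// mulrC.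
  by rewrite -subr_ge0 opprK addrC.
have hE n : \int[mu]_(r in `]0, +oo[) (b n / ((r - A n) ^+ 2 + b n ^+ 2) * g n r) =
    \int[mu]_v (h n v).
  rewrite -Rintegral_mkcond /Rintegral integral_itv_obnd_cbnd.
    by rewrite integral_poisson_affine//; exact: g0.
  apply/measurable_EFinP; apply: continuous_measurable_halfline => r r0.
  apply: cvgM; first exact: continuous_poisson_kernel.
  by move: (cg n) => /continuous_within_itvcyP[+ _]; exact.
under eq_cvg do rewrite hE.
have lpi : (\int[mu]_v (l / oneDsqr v)%:E = (l * pi)%:E)%E.
  under eq_integral do rewrite EFinM.
  by rewrite integralZl ?integralT_oneDsqr//; exact: integrableT_oneDsqr.
apply: fine_cvg; rewrite -lpi.
apply: (@dominated_cvg _ _ _ mu _ _ _ _ (fun v => M%:E * ((oneDsqr v)^-1)%:E)%E) => //.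
- move=> n; apply/measurable_EFinP.
  have mJ : measurable (J n) by exact: measurable_itv.
  rewrite (_ : h n = (fun v => g n (A n + b n * v) / oneDsqr v) \_ (J n))//.
  apply/(measurable_restrictT _ mJ); apply: measurable_funM.
    apply: (@measurable_comp _ _ _ _ _ _ (`[0, +oo[%classic : set R) (g n)) => //.
    - by move=> _ /= [v /JE Jv <-]; rewrite in_itv/= andbT.
    - by apply: subspace_continuous_measurable_fun; [exact: measurable_itv|exact: cg].
    - apply: measurable_funD => //; exact: measurable_funM.
  apply: measurable_funTS; have := @continuous_oneDsqrV R.
  exact: continuous_measurable_fun.
- move=> v _; apply: cvg_EFin; first exact: nearW.
  have cv : (fun n => A n + b n * v) @ \oo --> s.
    by rewrite -[X in _ --> X]addr0 -(mul0r v); apply: cvgD => //; apply: cvgMl.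
  apply: (@cvg_trans _ (g n (A n + b n * v) / oneDsqr v @[n --> \oo])).
    apply: near_eq_cvg; near=> n; rewrite /= /h patchE ifT// inE; apply/JE.
    by near: n; apply: (cvgr_ge s).
  by apply: cvgMl; exact: gl.
- exact: integrableZl integrableT_oneDsqr.
- move=> n v _; rewrite /h patchE -EFinM lee_fin.
  have ov : 0 < oneDsqr v by rewrite (lt_le_trans ltr01 (oneDsqr_ge1 v)).
  case: ifP => [/[!inE] /JE Jv|_]; last by rewrite normr0 divr_ge0// ltW.
  have /andP[ga gb] := gM n _ Jv.
  by rewrite ger0_norm ?divr_ge0 ?(ltW ov)// ler_pM2r ?invr_gt0.
Unshelve. all: end_near. Qed.

End poisson_limit.

(** * The Laplace kernel along a ray *)

Section norm_bounds.
Context {R : realType}.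
Implicit Types x y : R.

Lemma normM_le x y X Y : `|x| <= X -> `|y| <= Y -> `|x * y| <= X * Y.
Proof. by move=> *; rewrite normrM ler_pM. Qed.

Lemma normD_le x y X Y : `|x| <= X -> `|y| <= Y -> `|x + y| <= X + Y.
Proof. by move=> *; rewrite (le_trans (ler_normD _ _))// lerD. Qed.

Lemma normB_le x y X Y : `|x| <= X -> `|y| <= Y -> `|x - y| <= X + Y.
Proof. by move=> *; rewrite (le_trans (ler_normB _ _))// lerD. Qed.

End norm_bounds.

Section poisson_ray.
Context {R : realType}.
Notation mu := (@lebesgue_measure R).
Variables a t s : R.
Hypotheses (a0 : 0 < a) (a1 : a < 1) (t0 : 0 < t) (s0 : 0 < s).

Local Notation kappa := (t * cos (a * (pi / 2))).

(* With [z = r e^(i th)], the number [e^(- t z^a)] has modulus [expR (E r th)]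
   and argument [- F r th]. *)
Let E (r th : R) : R := - (t * r `^ a * cos (a * th)).
Let F (r th : R) : R := t * r `^ a * sin (a * th).
(* Both are [|s - z|^2], by the law of cosines: [D] exhibits the Poisson kernel
   centred at [s cos th], and [D'] comes from the division by [s - z]. *)
Let D (r th : R) : R := (r - s * cos th) ^+ 2 + (s * sin th) ^+ 2.
Let D' (r th : R) : R := (s - r * cos th) ^+ 2 + (r * sin th) ^+ 2.

(** The imaginary part of [e^(i th) e^(- t z^a) / (s - z)] at
    [z = r e^(i th)]. *)
Definition ray_res_im (r th : R) : R :=
  expR (E r th) * (s * sin (th - F r th) + r * sin (F r th)) / D' r th.

(** The real part of [z e^(- t z^a) / (s - z)]. *)
Definition ray_res_prim (r th : R) : R :=
  r * (expR (E r th) * (s * cos (th - F r th) - r * cos (F r th)) / D' r th).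
(* [N] is the numerator of [ray_res_im] without its exponential; [Nt] and [Dt]
   are the angular derivatives of [N] and of [D']. *)
Let N (r th : R) : R := s * sin (th - F r th) + r * sin (F r th).
Let Nt (r th : R) : R :=  s * cos (th - F r th) * (1 + a * E r th) - a * r * E r th * cos (F r th).
Let Dt (r th : R) : R := 2 * (s - r * cos th) * (r * sin th) + 2 * (r * sin th) * (r * cos th).
Definition ray_res_der (r th : R) : R :=
  expR (E r th) * ((a * F r th * N r th + Nt r th) / D' r th - N r th * Dt r th * (D' r th)^-1 ^+ 2).

Let D_eq (r th : R) : D' r th = D r th.
Proof.
rewrite /D' /D; have := cos2Dsin2 th; move: (cos th) (sin th) => c q cq.
have -> : (s - r * c) ^+ 2 + (r * q) ^+ 2 = s ^+ 2 - 2 * s * r * c + r ^+ 2 * (c ^+ 2 + q ^+ 2) by ring.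
have -> : (r - s * c) ^+ 2 + (s * q) ^+ 2 = r ^+ 2 - 2 * s * r * c + s ^+ 2 * (c ^+ 2 + q ^+ 2) by ring.
by rewrite cq; ring.
Qed.

Let D_neq0 (r th : R) : 0 < sin th -> D' r th != 0.
Proof.
move=> q0; rewrite D_eq /D lt0r_neq0// ltr_wpDl ?sqr_ge0// exprn_gt0//.
exact: mulr_gt0.
Qed.

Lemma is_derive_ray_res_im (r th : R) : 0 < sin th ->
  is_derive th 1 (ray_res_im r) (ray_res_der r th).
Proof.
move=> q0; have Dn0 := D_neq0 r q0.
have dD : is_derive th 1 (fun th => (D' r th)^-1) (- (D' r th) ^- 2 * Dt r th).
  have h : is_derive th 1 (D' r) (Dt r th).
    by apply: is_derive_eq; rewrite /Dt /GRing.scale/=; ring.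
  exact: is_deriveV.
apply: is_derive_eq.
rewrite /ray_res_der /Nt /N /GRing.scale/= -/(F r th) -/(E r th) -/(D' r th).
move: (expR _) (sin (th - _)) (cos (th - _)) (sin (F r th)) (cos (F r th)) (Dt r th).
move=> e sv cv sF cF d; rewrite /E /F; field; exact: Dn0.
Qed.

Let is_derive_Dinv (r th : R) : 0 < sin th ->
  is_derive r 1 (fun r => (D' r th)^-1)
    (- (D' r th) ^- 2 * (2 * (s - r * cos th) * (- cos th) + 2 * (r * sin th) * sin th)).
Proof.
move=> q0; have Dn0 := D_neq0 r q0.
have h : is_derive r 1 (D' ^~ th) (2 * (s - r * cos th) * (- cos th) + 2 * (r * sin th) * sin th).
  by apply: is_derive_eq; rewrite /GRing.scale/=; ring.
exact: is_deriveV.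
Qed.

Lemma is_derive_ray_res_prim (r th : R) : 0 < r -> 0 < sin th ->
  is_derive r 1 (ray_res_prim ^~ th) (ray_res_der r th).
Proof.
move=> r0 q0; have Dn0 := D_neq0 r q0.
have h := is_derive_powR a r0.
have dD := is_derive_Dinv r q0.
apply: is_derive_eq.
rewrite /ray_res_der /Nt /N /Dt /GRing.scale/= -/(F r th) -/(E r th) -/(D' r th).
rewrite sinB cosB /D'; move: Dn0; rewrite /D'; have := cos2Dsin2 th.
move: (expR _) (sin (F r th)) (cos (F r th)) (sin th) (cos th).
move=> e sF cF sv cv cv1 dn0; rewrite /E /F.
have {}cv1 : sv ^+ 2 = 1 - cv ^+ 2 by rewrite -cv1; ring.
(* The identity holds only modulo [sin^2 = 1 - cos^2]. *)
field: cv1.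
by rewrite dn0 lt0r_neq0.
Qed.

Lemma derivable_ray_res_im (r th : R) : 0 < r -> 0 < sin th ->
  derivable (ray_res_im ^~ th) r 1.
Proof.
move=> r0 q0; have dD := is_derive_Dinv r q0; have h := is_derive_powR a r0.
by apply: ex_derive.
Qed.

Lemma derivable_ray_res_der (r th : R) : 0 < r -> 0 < sin th ->
  derivable (ray_res_der ^~ th) r 1.
Proof.
move=> r0 q0; have dD := is_derive_Dinv r q0; have h := is_derive_powR a r0.
by apply: ex_derive.
Qed.

(** The integrand has a pole at [z = s]. While a ray turns from [pi / 2] down
    to [th0], a bound from below on the sine keeps it away from this pole. *)
Lemma sin_ge_half (th0 th : R) : 0 < th0 -> th0 <= pi / 2 ->
  th0 / 2 < th < pi - th0 / 2 -> sin (th0 / 2) <= sin th.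
Proof.
move=> th00 th0le /andP[h1 h2]; have pi0 := @pi_gt0 R.
wlog : th h1 h2 / th <= pi / 2 => [H|thle].
  have [thle|thgt] := leP th (pi / 2); first exact: H.
  have -> : sin th = sin (pi - th) by rewrite sinB sinpi cospi; ring.
  by apply: H; lra.
by rewrite ltW// ltr_sin// in_itv/=; apply/andP; split; lra.
Qed.

Let E_norm_le (r th M : R) : 0 <= r <= M -> `|E r th| <= t * M `^ a.
Proof.
move=> /andP[r0 rM]; rewrite normrN !normrM (gtr0_norm t0) (ger0_norm (powR_ge0 _ _)).
rewrite -[leRHS]mulr1 ler_pM ?cos_max ?mulr_ge0 ?(ltW t0) ?powR_ge0//.
by rewrite ler_pM2l// ge0_ler_powR ?nnegrE ?(ltW a0)// (le_trans r0).
Qed.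

Let F_norm_le (r th M : R) : 0 <= r <= M -> `|F r th| <= t * M `^ a.
Proof.
move=> /andP[r0 rM]; rewrite !normrM (gtr0_norm t0) (ger0_norm (powR_ge0 _ _)).
rewrite -[leRHS]mulr1 ler_pM ?sin_max ?mulr_ge0 ?(ltW t0) ?powR_ge0//.
by rewrite ler_pM2l// ge0_ler_powR ?nnegrE ?(ltW a0)// (le_trans r0).
Qed.

Let N_norm_le (r th : R) : 0 <= r -> `|N r th| <= s + r.
Proof.
move=> r0; rewrite (le_trans (ler_normD _ _))// !normrM (gtr0_norm s0) (ger0_norm r0).
by rewrite lerD// ler_piMr ?sin_max// ltW.
Qed.

Let D_ge (r th q : R) : 0 < q -> q <= sin th -> (s * q) ^+ 2 <= D' r th.
Proof.
move=> q0 qth; rewrite D_eq /D.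
have : (s * q) ^+ 2 <= (s * sin th) ^+ 2.
  by rewrite lerXn2r ?nnegrE ?mulr_ge0 ?ler_pM2l// ?(ltW s0)// ltW// (lt_le_trans q0).
by move/le_trans; apply; rewrite lerDr sqr_ge0.
Qed.

Lemma ray_res_der_bound (M q : R) : 0 < q -> exists K, forall r th : R,
  0 <= r <= M -> q <= sin th -> `|ray_res_der r th| <= K.
Proof.
move=> q0; pose L := t * M `^ a.
exists (expR L * ((L * (s + M) + (s * (1 + L) + M * L)) * (s * q) ^- 2 +
  (s + M) * (2 * (s + M) * M + 2 * M * M) * (s * q) ^- 2 ^+ 2)).
move=> r th rM qth; have /andP[r0 rM'] := rM; have M0 := le_trans r0 rM'.
have hE := E_norm_le th rM; have hF := F_norm_le th rM; rewrite -/L in hE hF.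
have L0 : 0 <= L := le_trans (normr_ge0 _) hE.
have hN : `|N r th| <= s + M by rewrite (le_trans (N_norm_le _ r0))// lerD2l.
have hD : 0 <= (D' r th)^-1 <= (s * q) ^- 2.
  have sq0 : 0 < (s * q) ^+ 2 by rewrite exprn_gt0// mulr_gt0.
  have Dge := D_ge r q0 qth; have D0 := lt_le_trans sq0 Dge.
  by rewrite invr_ge0 (ltW D0)/= lef_pV2 ?posrE.
have aE : `|a * E r th| <= L.
  by rewrite normrM (gtr0_norm a0) (le_trans _ hE)// ler_piMl// ltW.
have aF : `|a * F r th| <= L.
  by rewrite normrM (gtr0_norm a0) (le_trans _ hF)// ler_piMl// ltW.
have hs : `|s| <= s by rewrite gtr0_norm.
have hr : `|r| <= M by rewrite ger0_norm.
have h1 (z : R) : `|cos z| <= 1 := cos_max z.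
have h2 (z : R) : `|sin z| <= 1 := sin_max z.
have n2 : `|2 : R| <= 2 by rewrite ger0_norm.
have n1 : `|1 : R| <= 1 by rewrite normr1.
have hNt : `|Nt r th| <= s * (1 + L) + M * L.
  rewrite /Nt; apply: normB_le.
    by apply: normM_le; [rewrite -[leRHS]mulr1; exact: normM_le|exact: normD_le].
  rewrite -[leRHS]mulr1; apply: normM_le => //.
  by rewrite (mulrC a) -mulrA; exact: normM_le.
have hc (x : R) : `|r * x| <= M -> `|s - r * x| <= s + M by move=> ?; exact: normB_le.
have hrc : `|r * cos th| <= M by rewrite -[leRHS]mulr1; exact: normM_le.
have hrs : `|r * sin th| <= M by rewrite -[leRHS]mulr1; exact: normM_le.
have hDt : `|Dt r th| <= 2 * (s + M) * M + 2 * M * M.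
  by apply: normD_le; apply: normM_le => //; apply: normM_le => //; exact: hc.
have hV : `|(D' r th)^-1| <= (s * q) ^- 2 by case/andP: hD => ? ?; rewrite ger0_norm.
rewrite /ray_res_der; apply: normM_le.
  by rewrite ger0_norm ?expR_ge0// ler_expR (le_trans (ler_norm _)).
apply: normB_le; first by apply: normM_le => //; apply: normD_le => //; exact: normM_le.
apply: normM_le; first exact: normM_le.
by rewrite normrX; apply: lerXn2r => //; rewrite nnegrE invr_ge0 sqr_ge0.
Qed.

Lemma cos_powR_le (r th : R) : 0 <= th <= pi / 2 ->
  E r th <= - (kappa * r `^ a).
Proof.
move=> /andP[th0 thle]; rewrite /E lerN2 -!mulrA ler_pM2l// mulrC ler_wpM2l ?powR_ge0//.
have pi0 := @pi_gt0 R; move: (a0) (a1) => ga ga1.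
have : a * th <= a * (pi / 2) by rewrite ler_pM2l.
rewrite le_eqVlt => /predU1P[->//|h]; rewrite ltW// ltr_cos// in_itv/=.
  by apply/andP; split; nra.
by apply/andP; split; nra.
Qed.

(** The numerator [u] is arbitrary so that the estimate serves both
    [ray_res_im] and [ray_res_prim]. Half of the rate of decay absorbs the
    linear growth of [u]. *)
Lemma ray_res_le (q : R) : 0 < q -> exists K, forall r th u : R, 0 < r ->
  0 <= th <= pi / 2 -> q <= sin th -> `|u| <= s + r ->
  `|expR (E r th) * u / D' r th| <= K * expR (- (kappa / 2 * r `^ a)).
Proof.
move=> q0; have k0 := kappa_gt0 a0 a1 t0.
have k20 : 0 < kappa / 2 by rewrite divr_gt0.
have [K K0 HK] := expR_powR_decay 1 a0 k20.
exists ((s + 1) * K * (s * q) ^- 2) => r th u r0 thI qth hu.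
have sq0 : 0 < (s * q) ^+ 2 by rewrite exprn_gt0// mulr_gt0.
have Dge := D_ge r q0 qth; have D0 := lt_le_trans sq0 Dge.
rewrite normrM normfV (gtr0_norm D0) mulrAC ler_pM ?invr_ge0 ?(ltW D0)//; last first.
  by rewrite lef_pV2 ?posrE.
rewrite normrM (gtr0_norm (expR_gt0 _)).
apply: (@le_trans _ _ (expR (- (kappa * r `^ a)) * (s + r))).
  by rewrite ler_pM ?expR_ge0// ler_expR cos_powR_le.
have -> : - (kappa * r `^ a) = - (kappa / 2 * r `^ a) + - (kappa / 2 * r `^ a) by field.
rewrite expRD mulrAC ler_pM2r ?expR_gt0// mulrC.
apply: (@le_trans _ _ ((s + 1) * ((1 + r) ^+ 1 * expR (- (kappa / 2 * r `^ a))))).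
  rewrite expr1 [leRHS]mulrA ler_pM2r ?expR_gt0//; have := mulr_ge0 (ltW s0) (ltW r0); lra.
by rewrite ler_pM2l ?HK ?(ltW r0)// ltr_wpDl// ltW.
Qed.

Lemma continuous_ray_res_im (th : R) : 0 < sin th ->
  {in `]0, +oo[, continuous (ray_res_im ^~ th)}.
Proof.
by move=> q0; apply: derivable_in_continuous => r r0; exact: derivable_ray_res_im.
Qed.

Lemma integrable_ray_res_im (th : R) : 0 < th <= pi / 2 ->
  mu.-integrable `]0, +oo[ (EFin \o (ray_res_im ^~ th)).
Proof.
move=> /andP[th0 thI]; have pi0 := @pi_gt0 R.
have q0 : 0 < sin th by apply: sin_gt0_pi; rewrite th0/=; lra.
have [K HK] := ray_res_le q0.
have k20 : 0 < kappa / 2 by rewrite divr_gt0// kappa_gt0.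
apply: (integrable_le_expR_powR a0 k20 (K := K)) => [|r r0].
  by apply: continuous_measurable_halfline; exact: continuous_ray_res_im.
by apply: HK => //; [rewrite (ltW th0)|exact: N_norm_le (ltW r0)].
Qed.

(** No pole is met as long as the final angle [th0] is positive. *)
Lemma integral_ray_res_im (th0 : R) : 0 < th0 <= pi / 2 ->
  \int[mu]_(r in `]0, +oo[) ray_res_im r th0 =
  \int[mu]_(r in `]0, +oo[) ray_res_im r (pi / 2).
Proof.
move=> /andP[th00 th0le]; have pi0 := @pi_gt0 R.
have q0 : 0 < sin (th0 / 2) by apply: sin_gt0_pi; lra.
have qle (th : R) : th0 / 2 < th < pi - th0 / 2 -> sin (th0 / 2) <= sin th.
  exact: sin_ge_half.
have qpos (th : R) : th0 / 2 < th < pi - th0 / 2 -> 0 < sin th.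
  by move=> /qle; exact: lt_le_trans.
have k20 : 0 < kappa / 2 by rewrite divr_gt0// kappa_gt0.
have [K HK] := ray_res_le q0.
apply: (@integral_rotate_ray _ ray_res_im ray_res_prim ray_res_der
  (th0 / 2) (pi - th0 / 2) _ _
  (fun r => K * (r * expR (- (kappa / 2 * r `^ a))))).
- by lra.
- by lra.
- by lra.
- by move=> r th r0 thI; apply: is_derive_ray_res_im; exact: qpos.
- by move=> r th r0 thI; apply: is_derive_ray_res_prim => //; exact: qpos.
- by move=> th thI; apply: continuous_ray_res_im; exact: qpos.
- move=> th thI; apply: derivable_in_continuous => r r0.
  by apply: derivable_ray_res_der => //; exact: qpos.
- move=> e M e0; have [L HL] := ray_res_der_bound M q0.
  exists L => r th /andP[er rM] thI.
  by apply: HL; [rewrite (le_trans (ltW e0))|exact: qle].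
- move=> r th r0 /andP[th1 th2]; rewrite normrM (gtr0_norm r0) mulrCA ler_pM2l//.
  apply: HK => //; [lra|apply: qle; lra|].
  rewrite (le_trans (ler_normB _ _))// !normrM (gtr0_norm s0) (gtr0_norm r0).
  by rewrite lerD// ler_piMr ?cos_max// ltW.
- exact: cvg_mul_expR_powR0 k20 _.
- exact: cvg_mul_expR_powRy a0 k20 _.
- by apply: integrable_ray_res_im; lra.
- by apply: integrable_ray_res_im; lra.
Qed.

(* Dividing by [s - z] amounts to multiplying by
   [(s - conj z) / |s - z|^2], and [e^(i th) (s - conj z)] has imaginary part
   [s sin th]. So the real part of [e^(- t z^a)] comes with the Poisson kernel
   [P], and its imaginary part comes in [Q]. Adding 1 to the real part makes
   [q] nonnegative, as the substitution behind the Poisson limit wants; the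
   extra [P * 1] is subtracted. *)
Let q (r th : R) : R := expR (E r th) * cos (F r th) + 1.
Let Q (r th : R) : R := (r - s * cos th) * (expR (E r th) * sin (F r th)) / D r th.
Let P (r th : R) : R := s * sin th / D r th.

Let ray_res_im_split (r th : R) : ray_res_im r th = P r th * q r th - P r th * 1 + Q r th.
Proof.
rewrite /ray_res_im D_eq /P /q /Q sinB; set Dr := (D r th)^-1.
by move: (expR _) (sin th) (cos th) (sin _) (cos _) => *; ring.
Qed.

Let q_ge0 (r th : R) : 0 <= th <= pi / 2 -> 0 <= r -> 0 <= q r th <= 2.
Proof.
move=> thI r0; have Ele : expR (E r th) <= 1.
  rewrite -expR0 ler_expR (le_trans (cos_powR_le _ thI))// oppr_le0.
  by rewrite mulr_ge0 ?powR_ge0// ltW// kappa_gt0.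
have : `|expR (E r th) * cos (F r th)| <= 1.
  rewrite -[leRHS]mulr1; apply: normM_le; last exact: cos_max.
  by rewrite ger0_norm ?expR_ge0.
by rewrite /q ler_norml => /andP[? ?]; apply/andP; split; lra.
Qed.

(* The factor [1 / sin th] of the bound
   [|r - s cos th| / |s - z|^2 <= 1 / (2 s sin th)] is compensated by
   [|sin (F r th)| <= t r^a sin (a th) <= t r^a sin th]: thus [Q] stays bounded
   as [th] tends to 0, although its denominator degenerates at [r = s]. *)
Let Q_le (r th : R) : 0 < th <= pi / 2 -> 0 < r ->
  `|Q r th| <= t / (s * kappa) * expR (- (kappa / 2 * r `^ a)).
Proof.
move=> /andP[th0 th1] r0; have pi0 := @pi_gt0 R.
have k0 := kappa_gt0 a0 a1 t0.
have sth : 0 < sin th by apply: sin_gt0_pi; lra.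
have b0 : 0 < s * sin th by rewrite mulr_gt0.
have D0 : 0 < D r th by rewrite ltr_wpDl ?sqr_ge0// exprn_gt0.
have thI : 0 <= th <= pi / 2 by lra.
have h1 : `|r - s * cos th| / D r th <= (2 * (s * sin th))^-1.
  rewrite -[leRHS]mul1r ler_pdivlMr ?mulr_gt0// mulrAC ler_pdivrMr// mul1r.
  rewrite /D -[(r - _) ^+ 2]real_normK ?num_real//.
  have := sqr_ge0 (`|r - s * cos th| - s * sin th).
  by move: `|_| (s * sin th) => z b; lra.
have saF : `|sin (F r th)| <= t * r `^ a * sin th.
  rewrite (le_trans (normr_sin_le _))// normrM ger0_norm ?mulr_ge0 ?powR_ge0 ?(ltW t0)//.
  rewrite ler_wpM2l ?mulr_ge0 ?powR_ge0 ?(ltW t0)// ger0_norm ?sin_mull_le//.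
  by apply: sin_ge0_pi; move: (a0) (a1) => *; apply/andP; split; nra.
have hE : expR (E r th) <= expR (- (kappa * r `^ a)) by rewrite ler_expR cos_powR_le.
rewrite /Q mulrAC normrM [X in X * _]normrM normfV (gtr0_norm D0) normrM.
rewrite (gtr0_norm (expR_gt0 _)).
have hv : kappa / 2 * r `^ a <= expR (kappa / 2 * r `^ a).
  by rewrite (le_trans _ (expR_ge1Dx _))// lerDr.
apply: (@le_trans _ _ ((2 * (s * sin th))^-1 *
    (expR (- (kappa * r `^ a)) * (t * r `^ a * sin th)))).
  by rewrite ler_pM ?mulr_ge0 ?invr_ge0 ?(ltW D0) ?expR_ge0// ler_pM ?expR_ge0.
have -> : - (kappa * r `^ a) = - (kappa / 2 * r `^ a) + - (kappa / 2 * r `^ a) by field.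
rewrite expRD.
have -> : (2 * (s * sin th))^-1 *
  (expR (- (kappa / 2 * r `^ a)) * expR (- (kappa / 2 * r `^ a)) * (t * r `^ a * sin th))
  = t / (s * kappa) * (kappa / 2 * r `^ a * expR (- (kappa / 2 * r `^ a)))
   * expR (- (kappa / 2 * r `^ a)).
  by field; rewrite !lt0r_neq0//; move: k0; rewrite pmulr_rgt0.
rewrite ler_pM2r ?expR_gt0// ler_piMr ?divr_ge0 ?mulr_ge0 ?(ltW t0) ?(ltW s0) ?(ltW k0)//.
  by rewrite ltW// -(pmulr_rgt0 _ t0).
by rewrite expRN ler_pdivrMr ?expR_gt0// mul1r.
Qed.

Let thn (n : nat) : R := n.+1%:R^-1.

Let thn_itv n : 0 < thn n <= pi / 2.
Proof.
rewrite invr_gt0 ltr0n/= (le_trans _ (pihalf_ge1 R))//.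
by rewrite invf_le1// ler1n.
Qed.

Let cvg_thn : thn @ \oo --> 0.
Proof. exact: cvg_harmonic. Qed.

(* The exceptional point [r = s] is negligible. *)
Let cvg_Q (r : R) : 0 < r -> r != s -> Q r (thn n) @[n --> \oo] --> (0 : R).
Proof.
move=> r0 rs.
have ccos : cos (thn n) @[n --> \oo] --> (1 : R).
  by rewrite -[X in _ --> X]cos0; apply: continuous_cvg => //; exact: continuous_cos.
have csin : sin (thn n) @[n --> \oo] --> (0 : R).
  by rewrite -[X in _ --> X]sin0; apply: continuous_cvg => //; exact: continuous_sin.
have cath : a * thn n @[n --> \oo] --> (0 : R).
  by rewrite -[X in _ --> X](mulr0 a); exact: cvgMr.
have ccosa : cos (a * thn n) @[n --> \oo] --> (1 : R).
  by rewrite -[X in _ --> X]cos0; apply: continuous_cvg => //; exact: continuous_cos.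
have csina : sin (a * thn n) @[n --> \oo] --> (0 : R).
  by rewrite -[X in _ --> X]sin0; apply: continuous_cvg => //; exact: continuous_sin.
have cE : expR (E r (thn n)) @[n --> \oo] --> expR (- (t * r `^ a * 1)).
  apply: continuous_cvg; first exact: continuous_expR.
  by apply: cvgN; exact: cvgMr.
have cF : sin (F r (thn n)) @[n --> \oo] --> (0 : R).
  rewrite -[X in _ --> X]sin0; apply: continuous_cvg; first exact: continuous_sin.
  by rewrite -[X in _ --> X](mulr0 (t * r `^ a)); exact: cvgMr.
have -> : (0 : R) = (r - s * 1) * (expR (- (t * r `^ a * 1)) * 0) *
   ((r - s * 1) ^+ 2 + (s * 0) ^+ 2)^-1 by ring.
apply: cvgM; first by apply: cvgM; [apply: cvgB; [exact: cvg_cst|exact: cvgMr]|exact: cvgM].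
apply: cvgV.
  by rewrite mulr1 mulr0 expr0n addr0 sqrf_eq0 subr_eq0.
by apply: cvgD; rewrite expr2; under eq_cvg do rewrite expr2;
  apply: cvgM; (try apply: cvgB); (try exact: cvg_cst); exact: cvgMr.
Qed.

Let continuous_q (th : R) : {in `]0, +oo[, continuous (q ^~ th)}.
Proof.
apply: derivable_in_continuous => r r0; have h := is_derive_powR a r0.
by apply: ex_derive.
Qed.

Let measurable_P (th : R) : 0 < sin th ->
  measurable_fun (`]0, +oo[%classic : set R) (P ^~ th).
Proof.
move=> q0; apply: continuous_measurable_halfline => r _.
by apply: continuous_poisson_kernel; rewrite mulr_gt0.
Qed.

Let sin_thn_gt0 n : 0 < sin (thn n).
Proof. by have /andP[] := thn_itv n; have := @pi_gt0 R => *; apply: sin_gt0_pi; lra. Qed.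

Let cvg_int_Q : \int[mu]_(r in `]0, +oo[) Q r (thn n) @[n --> \oo] --> (0 : R).
Proof.
have mQ n : measurable_fun (`]0, +oo[%classic : set R) (Q ^~ (thn n)).
  have -> : Q ^~ (thn n) = (fun r => ray_res_im r (thn n) -
      (P r (thn n) * q r (thn n) - P r (thn n) * 1)).
    by apply/funext => r; rewrite ray_res_im_split; ring.
  have mq : measurable_fun (`]0, +oo[%classic : set R) (q ^~ (thn n)).
    by apply: continuous_measurable_halfline; exact: continuous_q.
  have mP := measurable_P (sin_thn_gt0 n).
  apply: measurable_funB.
    by apply: continuous_measurable_halfline; apply: continuous_ray_res_im.
  by apply: measurable_funB; exact: measurable_funM.
have k0 := kappa_gt0 a0 a1 t0; have k20 : 0 < kappa / 2 by rewrite divr_gt0.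
have := @dominated_convergence _ _ _ mu (`]0, +oo[%classic) _
  (fun n r => (Q r (thn n))%:E) (cst 0)%E
  (fun r => (t / (s * kappa) * expR (- (kappa / 2 * r `^ a)))%:E).
case.
- by [].
- by move=> n; apply/measurable_EFinP; exact: mQ.
- by [].
- exists [set s]; split; [exact: measurable_set1|exact: lebesgue_measure_set1|].
  move=> r /=; apply: contra_notP => rs; rewrite in_itv/= andbT => r0.
  apply: cvg_EFin; first exact: nearW.
  by apply: cvg_Q => //; apply/eqP.
- exact: integrable_expR_powR.
- apply/aeW => r n; rewrite /= in_itv/= andbT => r0; rewrite lee_fin.
  exact: Q_le.
- move=> _ _; rewrite integral0 => h.
  by apply: fine_cvg.
Qed.

Let within_continuous_q (th : R) : {within `[0, +oo[, continuous (q ^~ th)}.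
Proof.
apply/continuous_within_itvcyP; split; first exact: continuous_q.
have c0 : r `^ a @[r --> (0 : R)^'+] --> (0 : R) `^ a.
  by rewrite powR0 ?(lt0r_neq0 a0)//; exact: powR_cvg0.
rewrite /q /E /F; apply: cvgD; last exact: cvg_cst.
apply: cvgM; apply: continuous_cvg; try exact: continuous_expR; try exact: continuous_cos.
  by apply: cvgN; apply: cvgMl; exact: cvgMr.
by apply: cvgMl; exact: cvgMr.
Qed.

Let cvg_q (x_ : R ^nat) : x_ @ \oo --> s ->
  q (x_ n) (thn n) @[n --> \oo] --> expR (- (t * s `^ a)) + 1.
Proof.
move=> xs; have cpow : x_ n `^ a @[n --> \oo] --> s `^ a.
  have ca : {in `]0, +oo[, continuous (fun y : R => y `^ a)}.
    by apply: derivable_in_continuous => r r0; have [] := is_derive_powR a r0.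
  have cs : {for s, continuous (fun y : R => y `^ a)}.
    by apply: ca; rewrite in_itv/= andbT.
  exact: (continuous_cvg _ cs xs).
have cath : a * thn n @[n --> \oo] --> (0 : R).
  by rewrite -[X in _ --> X](mulr0 a); exact: cvgMr.
rewrite -[X in X + 1]mulr1 -[in X in _ * X + 1](cos0 R) -[in X in cos X](mulr0 (t * s `^ a)).
rewrite -[in X in - X](mulr1 (t * s `^ a)).
apply: cvgD; last exact: cvg_cst.
apply: cvgM; apply: continuous_cvg; try exact: continuous_expR; try exact: continuous_cos.
  apply: cvgN; apply: cvgM; first exact: cvgMr.
  by rewrite -[X in _ --> X]cos0; apply: continuous_cvg => //; exact: continuous_cos.
apply: cvgM; first exact: cvgMr.
by rewrite -[X in _ --> X]sin0; apply: continuous_cvg => //; exact: continuous_sin.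
Qed.

(** By rotation the integral is the same for every angle [th] with
    [0 < th <= pi / 2]. Letting the angle tend to 0, the ray approaches the
    pole [s] and the Poisson kernel extracts the value of [e^(- t z^a)] at
    [z = s]. This plays the role of the residue theorem. *)
Lemma integral_ray_res_pihalf :
  \int[mu]_(r in `]0, +oo[) ray_res_im r (pi / 2) = expR (- (t * s `^ a)) * pi.
Proof.
have b0 n : 0 < s * sin (thn n) by rewrite mulr_gt0.
have cA : s * cos (thn n) @[n --> \oo] --> s.
  rewrite -[X in _ --> X]mulr1 -(cos0 R); apply: cvgMr.
  by apply: continuous_cvg => //; exact: continuous_cos.
have cb : s * sin (thn n) @[n --> \oo] --> (0 : R).
  rewrite -[X in _ --> X](mulr0 s) -(sin0 R); apply: cvgMr.
  by apply: continuous_cvg => //; exact: continuous_sin.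
have thn_itv' n : 0 <= thn n <= pi / 2 by have /andP[/ltW -> ->] := thn_itv n.
have cPq : \int[mu]_(r in `]0, +oo[) (P r (thn n) * q r (thn n)) @[n --> \oo] -->
    (expR (- (t * s `^ a)) + 1) * pi.
  apply: (@cvg_poisson_integral _ _ _ (fun n r => q r (thn n)) s _ 2 b0 cA cb s0) => //.
  by move=> n x x0; exact: q_ge0.
have cP : \int[mu]_(r in `]0, +oo[) (P r (thn n) * 1) @[n --> \oo] --> 1 * pi.
  apply: (@cvg_poisson_integral _ _ _ (fun _ _ => 1) s _ 2 b0 cA cb s0) => //.
  - by move=> n; apply: continuous_subspaceT => x; exact: cst_continuous.
  - by move=> n x _; rewrite ler01 ler1n.
  - by move=> x_ _; exact: cvg_cst.
have split n : \int[mu]_(r in `]0, +oo[) ray_res_im r (pi / 2) =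
    \int[mu]_(r in `]0, +oo[) (P r (thn n) * q r (thn n)) -
    \int[mu]_(r in `]0, +oo[) (P r (thn n) * 1) +
    \int[mu]_(r in `]0, +oo[) Q r (thn n).
  rewrite -(integral_ray_res_im (thn_itv n)).
  have iP1 : mu.-integrable `]0, +oo[ (EFin \o (fun r => P r (thn n) * 1)).
    apply: eq_integrable (integrable_poisson_kernel (s * cos (thn n)) (b0 n)) => //.
    by move=> r _; rewrite /= mulr1.
  have P0 r : 0 <= P r (thn n).
    by rewrite divr_ge0 ?(ltW (b0 n))// addr_ge0 ?sqr_ge0.
  have iPq : mu.-integrable `]0, +oo[ (EFin \o (fun r => P r (thn n) * q r (thn n))).
    apply: (le_integrable _ _ _ (integrableZl _ 2 iP1)) => //.
      apply/measurable_EFinP; apply: measurable_funM; first exact: measurable_P.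
      by apply: continuous_measurable_halfline; exact: continuous_q.
    move=> r; rewrite /= in_itv/= andbT => /ltW r0; rewrite lee_fin mulr1.
    have /andP[q0 q2] := q_ge0 (thn_itv' n) r0.
    by rewrite !normrM (ger0_norm q0) mulrC ler_wpM2r// ger0_norm.
  have iQ : mu.-integrable `]0, +oo[ (EFin \o (Q ^~ (thn n))).
    have -> : EFin \o Q ^~ (thn n) = ((EFin \o (ray_res_im ^~ (thn n))) \-
      ((EFin \o (fun r => (P r (thn n) * q r (thn n))%R)) \-
       (EFin \o (fun r => (P r (thn n) * 1)%R))))%E.
      by apply/funext => r /=; rewrite -!EFinB ray_res_im_split; congr EFin; ring.
    apply: integrableB => //; first exact: integrable_ray_res_im.
    exact: integrableB.
  have iB : mu.-integrable `]0, +oo[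
      (EFin \o (fun r => P r (thn n) * q r (thn n) - P r (thn n) * 1)).
    by apply: eq_integrable (integrableB _ iPq iP1).
  rewrite -RintegralB// -RintegralD//.
  by apply: eq_Rintegral => r _; rewrite ray_res_im_split.
have lim : (fun=> \int[mu]_(r in `]0, +oo[) ray_res_im r (pi / 2)) @ \oo -->
    (expR (- (t * s `^ a)) + 1) * pi - 1 * pi + 0.
  rewrite (_ : (fun=> _) = (fun n =>
      \int[mu]_(r in `]0, +oo[) (P r (thn n) * q r (thn n)) -
      \int[mu]_(r in `]0, +oo[) (P r (thn n) * 1) +
      \int[mu]_(r in `]0, +oo[) Q r (thn n))); last exact/funext.
  by apply: cvgD => //; exact: cvgB.
transitivity ((expR (- (t * s `^ a)) + 1) * pi - 1 * pi + 0); last by ring.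
by rewrite -(cvg_lim (@Rhausdorff R) lim) lim_cst//; exact: Rhausdorff.
Qed.

End poisson_ray.

(** * An exponential series of sines *)

Section exp_sin_series.
Context {R : realType}.
Variable phi : R.

(** The phase [d] makes the family stable under differentiation, which only
    adds [phi] to it. *)
Definition exp_sin_coeff (d : R) : R ^nat := fun k => sin (d + k%:R * phi) / k`!%:R.

Lemma normr_exp_sin_coeff (d v : R) k :
  `|exp_sin_coeff d k * v ^+ k| <= exp_coeff `|v| k.
Proof.
rewrite /exp_sin_coeff /exp_coeff/= normrM normrM normfV normr_nat normrX.
by rewrite mulrAC ler_pM2r ?invr_gt0 ?ltr0n ?fact_gt0// ler_piMl ?exprn_ge0// sin_max.
Qed.

Lemma is_cvg_exp_sin (d v : R) : cvgn (pseries (exp_sin_coeff d) v).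
Proof.
apply: normed_cvg; apply: series_le_cvg; last exact: (is_cvg_series_exp_coeff `|v|).
- by move=> n; rewrite normr_ge0.
- by move=> n; exact: exp_coeff_ge0.
- by move=> n; exact: normr_exp_sin_coeff.
Qed.

Lemma pseries_diffs_exp_sin (d : R) :
  pseries_diffs (exp_sin_coeff d) = exp_sin_coeff (d + phi).
Proof.
apply/funext => i; rewrite /pseries_diffs /exp_sin_coeff factS natrM invfM.
rewrite mulrCA mulVKf//; congr (sin _ / _).
by rewrite -natr1 mulrDl mul1r; ring.
Qed.

Let W (d v : R) : R := limn (pseries (exp_sin_coeff d) v).

Let is_derive_W (d v : R) : is_derive v 1 (W d) (W (d + phi) v).
Proof.
rewrite /W -pseries_diffs_exp_sin.
apply: (@pseries_snd_diffs _ _ (`|v| + 1)); rewrite ?pseries_diffs_exp_sin;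
  try exact: is_cvg_exp_sin.
by rewrite [ltRHS]ger0_norm// ltrDl.
Qed.

Let WD (d e v : R) : W (d + e) v = cos e * W d v + sin e * W (d + pi / 2) v.
Proof.
apply/cvg_lim; first exact: Rhausdorff.
have -> : pseries (exp_sin_coeff (d + e)) v = (fun n =>
    cos e * pseries (exp_sin_coeff d) v n + sin e * pseries (exp_sin_coeff (d + pi / 2)) v n).
  apply/funext => n; rewrite /pseries /series/= !mulr_sumr -big_split/=.
  apply: eq_bigr => k _; rewrite /exp_sin_coeff.
  rewrite [d + e + _](_ : _ = (d + k%:R * phi) + e); last by ring.
  rewrite [d + _ / _ + _](_ : _ = (d + k%:R * phi) + pi / 2); last by ring.
  by rewrite sinDpihalf sinD; ring.
by apply: cvgD; apply: cvgMr; exact: is_cvg_exp_sin.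
Qed.

Lemma pseries0 (f : R ^nat) : pseries f 0 @ \oo --> f 0%N.
Proof.
rewrite -cvg_shiftS /=; apply: cvg_near_cst; apply: nearW => n.
rewrite /pseries /series/= big_nat_recl// expr0 mulr1 big1 ?addr0// => i _.
by rewrite expr0n mulr0.
Qed.

(** This is the imaginary part of [exp (v e^(i phi))]. The sums [S] and [C]
    with phases 0 and [pi / 2] satisfy [S' = cos phi S + sin phi C] and
    [C' = cos phi C - sin phi S]; the solution of this linear system is known,
    so that [S] and [C], once damped and rotated back into [g] and [h], are
    constant. *)
Lemma cvg_exp_sin (v : R) :
  pseries (exp_sin_coeff 0) v @ \oo --> expR (v * cos phi) * sin (v * sin phi).
Proof.
suff <- : W 0 v = expR (v * cos phi) * sin (v * sin phi) by exact: is_cvg_exp_sin.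
pose S := W 0; pose C := W (pi / 2).
have dS (x : R) : is_derive x 1 S (cos phi * S x + sin phi * C x).
  by apply: (is_derive_eq (is_derive_W 0 x)); rewrite WD /S /C !add0r.
have dC (x : R) : is_derive x 1 C (cos phi * C x - sin phi * S x).
  apply: (is_derive_eq (is_derive_W (pi / 2) x)); rewrite WD.
  rewrite [pi / 2 + _](_ : _ = 0 + pi); last by field.
  by rewrite WD cospi sinpi /S /C; ring.
pose g (x : R) := expR (- (x * cos phi)) * (S x * cos (x * sin phi) - C x * sin (x * sin phi)).
pose h (x : R) := expR (- (x * cos phi)) * (C x * cos (x * sin phi) + S x * sin (x * sin phi)).
have g' (x : R) : is_derive x 1 g 0.
  by apply: is_derive_eq; rewrite /GRing.scale/=; ring.
have h' (x : R) : is_derive x 1 h 0.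
  by apply: is_derive_eq; rewrite /GRing.scale/=; ring.
have W0 d : W d 0 = sin d.
  rewrite /W (cvg_lim (@Rhausdorff R) (@pseries0 _)) /exp_sin_coeff mul0r addr0.
  by rewrite fact0 divr1.
have g0 : g v = 0.
  rewrite (is_derive_0_is_cst v 0 g').
  by rewrite /g /S /C !W0 sin0 !mul0r sin0; ring.
have h1 : h v = 1.
  rewrite (is_derive_0_is_cst v 0 h').
  by rewrite /h /S /C !W0 sin0 sin_pihalf !mul0r cos0 oppr0 expR0; ring.
have e0 := lt0r_neq0 (expR_gt0 (- (v * cos phi))).
have -> : W 0 v = S v by [].
have cs := cos2Dsin2 (v * sin phi).
have {}h1 : C v * cos (v * sin phi) + S v * sin (v * sin phi) = expR (v * cos phi).
  apply: (mulfI e0); rewrite -expRD addNr expR0; exact: h1.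
have {}g0 : S v * cos (v * sin phi) - C v * sin (v * sin phi) = 0.
  by apply: (mulfI e0); rewrite mulr0; exact: g0.
rewrite -h1 -[LHS]mulr1 -cs.
move: g0; set c := cos (v * _); set s := sin (v * _) => g0.
have -> : S v * (c ^+ 2 + s ^+ 2) = (S v * c - C v * s) * c + (C v * c + S v * s) * s by ring.
by rewrite g0 mul0r add0r.
Qed.

End exp_sin_series.

(** * Gamma integrals *)

Section gamma.
Context {R : realType}.
Notation mu := (@lebesgue_measure R).

Lemma continuous_powR_gt0 (p : R) : {in `]0, +oo[, continuous (fun u : R => u `^ p)}.
Proof. by apply: derivable_in_continuous => r r0; have [] := is_derive_powR p r0. Qed.

Lemma within_continuous_powR (p : R) : 0 <= p ->
  {within `[0, +oo[, continuous (fun u : R => u `^ p)}.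
Proof.
move=> p0; apply/continuous_within_itvcyP; split; first exact: continuous_powR_gt0.
move: p0; rewrite le_eqVlt => /predU1P[<-|p0].
  by under eq_cvg do rewrite powRr0; rewrite powRr0; exact: cvg_cst.
by rewrite powR0 ?(lt0r_neq0 p0)//; exact: powR_cvg0.
Qed.

Lemma continuous_expRN (x : R) : continuous (fun u : R => expR (- (x * u))).
Proof.
move=> u; apply: continuous_comp; last exact: continuous_expR.
by apply: continuousN; apply: continuousM => //; exact: cst_continuous.
Qed.

Lemma within_continuous_powR_expR (p x : R) : 0 <= p ->
  {within `[0, +oo[, continuous (fun u : R => u `^ p * expR (- (x * u)))}.
Proof.
move=> /within_continuous_powR /continuous_within_itvcyP[cp cp0].
have ce := @continuous_expRN x.
apply/continuous_within_itvcyP; split.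
  by move=> u u0; apply: cvgM; [exact: cp|exact: ce].
by apply: cvgM => //; apply: cvg_at_right_filter; exact: ce.
Qed.

Lemma integrable_powR_expR (p x : R) : 0 <= p -> 0 < x ->
  mu.-integrable `]0, +oo[ (EFin \o (fun u => u `^ p * expR (- (x * u)))).
Proof.
move=> p0 x0; have x20 : 0 < x / 2 by rewrite divr_gt0.
pose n := (Num.truncn p).+1.
have pn : p <= n%:R by rewrite ltW// truncnS_gt.
have [K K0 HK] := expR_powR_decay n ltr01 x20.
apply: (@integrable_le_expR_powR _ 1 (x / 2) ltr01 x20 _ K) => [|u u0].
  apply: continuous_measurable_halfline => u u0.
  by apply: cvgM; [exact: continuous_powR_gt0|exact: continuous_expRN].
rewrite ger0_norm ?mulr_ge0 ?powR_ge0 ?expR_ge0//.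
have := HK _ (ltW u0); rewrite powRr1 ?(ltW u0)// => {}HK.
have -> : - (x * u) = - (x / 2 * u) + - (x / 2 * u) by field.
rewrite expRD mulrA ler_pM2r ?expR_gt0// (le_trans _ HK)// ler_pM2r ?expR_gt0//.
apply: (@le_trans _ _ ((1 + u) `^ p)).
  by rewrite ge0_ler_powR ?nnegrE ?addr_ge0 ?(ltW u0)// lerDr.
by rewrite -powR_mulrn ?addr_ge0 ?(ltW u0)// ler_powR// lerDl ltW.
Qed.

Lemma Gamma_scale (p x : R) : 0 <= p -> 0 < x ->
  Gamma (1 + p) * x `^ (- (1 + p)) =
  \int[mu]_(u in `]0, +oo[) (u `^ p * expR (- (x * u))).
Proof.
move=> p0 x0; pose F (v : R) := x * v.
have dF (v : R) : is_derive v 1 F x.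
  by apply: is_derive_eq; rewrite /GRing.scale/=; ring.
have F'E : F^`()%classic = cst x.
  by apply/funext => v; rewrite derive1E; have [_ ->] := dF v.
have mG (y : R) : measurable_fun (`]0, +oo[%classic : set R)
    (fun u : R => u `^ p * expR (- (y * u))).
  apply: continuous_measurable_halfline => u u0.
  by apply: cvgM; [exact: continuous_powR_gt0|exact: continuous_expRN].
have subst : (\int[mu]_(u in `[0%R, +oo[) (u `^ p * expR (- u))%:E =
    \int[mu]_(u in `[0%R, +oo[) (x `^ (1 + p) * (u `^ p * expR (- (x * u))))%:E)%E.
  have := @increasing_ge0_integration_by_substitutiony _ F
    (fun u : R => u `^ p * expR (- u)) 0.
  rewrite [F 0]mulr0 => ->.
  - apply: eq_integral => v; rewrite inE/= in_itv/= andbT => v0; congr EFin.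
    rewrite F'E !fctE /F /= powRM ?(ltW x0)// powRD ?powRr1 ?(ltW x0)//.
      by ring.
    by rewrite (lt0r_neq0 x0) implybT.
  - by move=> u v _ _ uv; rewrite /F ltr_pM2l.
  - by rewrite F'E => u _; exact: cst_continuous.
  - by rewrite F'E; exact: is_cvg_cst.
  - by rewrite F'E; exact: is_cvg_cst.
  - split; first by move=> v _; have [] := dF v.
    apply: cvg_at_right_filter; apply: differentiable_continuous.
    by apply/derivable1_diffP; have [] := dF 0.
  - apply/cvgryPge => y; near=> v; rewrite /F -ler_pdivrMl//.
  - have := @within_continuous_powR_expR p 1 p0.
    by under [X in {within _, continuous X}]eq_fun do rewrite mul1r.
  - by move=> v _; rewrite mulr_ge0 ?powR_ge0 ?expR_ge0.
rewrite /Gamma (_ : 1 + p - 1 = p); last by ring.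
rewrite {1}/Rintegral integral_itv_obnd_cbnd; last first.
  apply/measurable_EFinP.
  by apply: eq_measurable_fun (mG 1) => u _; rewrite /= mul1r.
rewrite subst -integral_itv_obnd_cbnd; last first.
  apply/measurable_EFinP; apply: measurable_funM => //.
rewrite -/(Rintegral _ _ _) RintegralZl//; last exact: integrable_powR_expR.
rewrite powRN mulrAC mulfV ?mul1r// lt0r_neq0// powR_gt0//.
Unshelve. all: end_near. Qed.
End gamma.

(** * The series as an integral along the imaginary axis *)

Section tss_series.
Context {R : realType}.
Notation mu := (@lebesgue_measure R).
Variables a t x : R.
Hypotheses (a0 : 0 < a) (a1 : a < 1) (t0 : 0 < t) (x0 : 0 < x).

(* The terms of the expansion of [ray_exp_im a t x u pi], obtained by
   applying [cvg_exp_sin] with [phi = pi * a] and [v = - (t * u `^ a)]. *)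
Let g (k : nat) (u : R) : R :=
  - (expR (- (x * u)) * (exp_sin_coeff (pi * a) 0 k * (- (t * u `^ a)) ^+ k)).

Let gE (k : nat) (u : R) : 0 <= u -> g k u =
  (-1) ^+ k.+1 / k`!%:R * t ^+ k * sin (pi * a * k%:R) *
  (u `^ (k%:R * a) * expR (- (x * u))).
Proof.
move=> u0; rewrite /g /exp_sin_coeff add0r (mulrC k%:R).
rewrite -[- (t * _)]mulN1r !exprMn (mulrC k%:R a) powRrM powR_mulrn ?powR_ge0//.
by rewrite exprS; ring.
Qed.

Let integrable_g k : mu.-integrable `]0, +oo[ (EFin \o g k).
Proof.
have ka : 0 <= k%:R * a by rewrite mulr_ge0 ?(ltW a0).
apply: eq_integrable (integrableZl _
  ((-1) ^+ k.+1 / k`!%:R * t ^+ k * sin (pi * a * k%:R)) (integrable_powR_expR ka x0)) => //.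
by move=> u; rewrite inE/= in_itv/= andbT => /ltW u0; rewrite gE.
Qed.

Let tss_termE k : tss_term a x t k = pi^-1 * \int[mu]_(u in `]0, +oo[) g k u.
Proof.
have ka : 0 <= k%:R * a by rewrite mulr_ge0 ?(ltW a0).
have -> : \int[mu]_(u in `]0, +oo[) g k u = \int[mu]_(u in `]0, +oo[)
    ((-1) ^+ k.+1 / k`!%:R * t ^+ k * sin (pi * a * k%:R) *
     (u `^ (k%:R * a) * expR (- (x * u)))).
  by apply: eq_Rintegral => u; rewrite inE/= in_itv/= andbT => /ltW; exact: gE.
rewrite RintegralZl//; last exact: integrable_powR_expR.
rewrite -Gamma_scale// /tss_term (mulrC a k%:R).
by rewrite invfM; ring.
Qed.

Let G (n : nat) (u : R) : R := \sum_(0 <= k < n) g k u.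

Let integrable_G n : mu.-integrable `]0, +oo[ (EFin \o G n).
Proof.
elim: n => [|n ih].
  apply: eq_integrable (integrable0 _ _) => // u _.
  by rewrite /G /= big_geq.
apply: eq_integrable (integrableD _ ih (integrable_g n)) => // u _.
by rewrite /G /= big_nat_recr.
Qed.

Let seriesE n : series (tss_term a x t) n = pi^-1 * \int[mu]_(u in `]0, +oo[) G n u.
Proof.
elim: n => [|n ih].
  rewrite /series/= big_geq// (_ : G 0%N = cst 0) ?Rintegral_cst ?mul0r ?mulr0//.
  by apply/funext => u; rewrite /G big_geq.
rewrite seriesSr ih tss_termE -mulrDr -RintegralD//.
by congr (_ * _); apply: eq_Rintegral => u _; rewrite /G big_nat_recr.
Qed.

Let G_le n u : 0 < u -> `|G n u| <= expR (- (x * u)) * expR (t * u `^ a).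
Proof.
move=> u0; have v0 : 0 <= t * u `^ a by rewrite mulr_ge0 ?powR_ge0 ?ltW.
rewrite /G sumrN normrN -mulr_sumr normrM (ger0_norm (expR_ge0 _)).
rewrite ler_pM2l ?expR_gt0// (le_trans (ler_norm_sum _ _ _))//.
apply: (@le_trans _ _ (series (exp_coeff (t * u `^ a)) n)).
  apply: ler_sum => k _; rewrite (le_trans (normr_exp_sin_coeff _ _ _ _))//.
  by rewrite normrN (ger0_norm v0).
apply: nondecreasing_cvgn_le; last exact: is_cvg_series_exp_coeff.
by apply: nondecreasing_series => k _ _; exact: exp_coeff_ge0.
Qed.

Let cvg_G u : 0 < u -> G n u @[n --> \oo] --> ray_exp_im a t x u pi.
Proof.
move=> u0.
have -> : (fun n => G n u) = (fun n =>
    - (expR (- (x * u)) * pseries (exp_sin_coeff (pi * a) 0) (- (t * u `^ a)) n)).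
  by apply/funext => n; rewrite /G sumrN -mulr_sumr.
have -> : ray_exp_im a t x u pi = - (expR (- (x * u)) *
    (expR (- (t * u `^ a) * cos (pi * a)) * sin (- (t * u `^ a) * sin (pi * a)))).
  rewrite /ray_exp_im cospi sinpi mulr0 addr0 (mulrC a pi).
  rewrite sinB sinpi cospi !mulNr sinN expRD.
  by rewrite mulrN1; ring.
by apply: cvgN; apply: cvgMr; exact: cvg_exp_sin.
Qed.

(** Each term is a Gamma integral, so the partial sums are integrals of those
    of an exponential series. They are dominated by [e^(- x u + t u^a)], which
    is integrable since [a < 1], and dominated convergence gives the integral
    along the ray of angle [pi]; it is rotated to the angle [pi / 2]. *)
Lemma cvg_tss_series :
  series (tss_term a x t) @ \oo -->
    pi^-1 * \int[mu]_(r in `]0, +oo[) ray_exp_im a t x r (pi / 2).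
Proof.
rewrite integral_ray_exp_im//.
have -> : series (tss_term a x t) = (fun n => pi^-1 * \int[mu]_(u in `]0, +oo[) G n u).
  by apply/funext => n; rewrite seriesE.
apply: cvgMr.
have pi0 := @pi_gt0 R.
have x20 : 0 < x / 2 by rewrite divr_gt0.
have [K HK] := powR_le_affine (ltW a0) a1 (ltW t0) x20.
have ipi : mu.-integrable `]0, +oo[ (EFin \o (ray_exp_im a t x ^~ pi)).
  by apply: integrable_ray_exp_im => //; lra.
apply: fine_cvg; rewrite fineK; last exact: integrable_fin_num.
apply: (@dominated_cvg _ _ _ mu _ _ _ _
  (fun u => (expR K * expR (- (x / 2 * u `^ 1)))%:E)) => //.
- by move=> n; have /integrableP[] := integrable_G n.
- move=> u; rewrite /= in_itv/= andbT => u0.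
  by apply: cvg_EFin; [exact: nearW|exact: cvg_G].
- exact: integrable_expR_powR.
- move=> n u; rewrite /= in_itv/= andbT => u0; rewrite lee_fin.
  rewrite (le_trans (G_le n u0))// -!expRD ler_expR powRr1 ?(ltW u0)//.
  by have := HK u (ltW u0); lra.
Qed.

End tss_series.

(** * The Laplace transform of the stable density *)

Section stable_wave.
Context {R : realType}.
Notation mu := (@lebesgue_measure R).
Variables a t : R.
Hypotheses (a0 : 0 < a) (a1 : a < 1) (t0 : 0 < t).

Local Notation kappa := (t * cos (a * (pi / 2))).
Let phase (r : R) : R := t * r `^ a * sin (a * (pi / 2)).

(** On [x > 0] this is [pi] times the density at time [t] of the stable
    subordinator without tempering, see [cvg_tss_series]. Unlike the series it
    makes sense for all real [x], and it is bounded and continuous. *)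
Definition stable_wave (x : R) : R :=
  \int[mu]_(r in `]0, +oo[) ray_exp_im a t x r (pi / 2).

Lemma ray_exp_im_pihalf (x r : R) : ray_exp_im a t x r (pi / 2) =
  expR (- (kappa * r `^ a)) * cos (x * r - phase r).
Proof.
rewrite /ray_exp_im cos_pihalf sin_pihalf mulr0 sub0r mulr1 -addrA addrC sinDpihalf.
by congr (expR _ * cos _); rewrite /phase; ring.
Qed.

Lemma normr_ray_exp_im_pihalf (x r : R) :
  `|ray_exp_im a t x r (pi / 2)| <= expR (- (kappa * r `^ a)).
Proof.
by rewrite ray_exp_im_pihalf normrM ger0_norm ?expR_ge0// ler_piMr ?expR_ge0// cos_max.
Qed.

Lemma integrable_ray_exp_im_pihalf (x : R) :
  mu.-integrable `]0, +oo[ (EFin \o (fun r => ray_exp_im a t x r (pi / 2))).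
Proof.
apply: (integrable_le_expR_powR a0 (kappa_gt0 a0 a1 t0) (K := 1)) => [|r r0].
  by apply: continuous_measurable_halfline; exact: continuous_ray_exp_im.
by rewrite mul1r normr_ray_exp_im_pihalf.
Qed.

Lemma integrable_expR_kappa :
  mu.-integrable `]0, +oo[ (EFin \o (fun r => expR (- (kappa * r `^ a)))).
Proof.
have := integrable_expR_powR a0 (kappa_gt0 a0 a1 t0) 1.
by apply: eq_integrable => // r _; rewrite /= mul1r.
Qed.

Lemma normr_stable_wave_le (x : R) :
  `|stable_wave x| <= \int[mu]_(r in `]0, +oo[) expR (- (kappa * r `^ a)).
Proof.
have ix := integrable_ray_exp_im_pihalf x.
rewrite (le_trans (le_normr_Rintegral _ ix))//.
apply: le_Rintegral => //; [exact: integrable_norm|exact: integrable_expR_kappa|].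
by move=> r _; exact: normr_ray_exp_im_pihalf.
Qed.

Lemma continuous_stable_wave : continuous stable_wave.
Proof.
move=> x; have mD : measurable (`]0, +oo[%classic : set (measurableTypeR R)) by [].
have xI : x \in (`]x - 1, x + 1[%classic : set R).
  by rewrite inE/= in_itv/=; apply/andP; split; lra.
apply: (@continuity_under_integral R _ _ mu
  (fun x r => ray_exp_im a t x r (pi / 2)) _ mD (x - 1) (x + 1) _ _
  (fun r => expR (- (kappa * r `^ a))) _ _ _ xI).
- by move=> y _; exact: integrable_ray_exp_im_pihalf.
- apply/aeW => r _ y _.
  under [X in continuous_at _ X]eq_fun do rewrite ray_exp_im_pihalf.
  apply: cvgM; first exact: cvg_cst.
  apply: continuous_cvg; first exact: continuous_cos.
  by apply: cvgB; [exact: cvgMl|exact: cvg_cst].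
- exact: integrable_expR_kappa.
- by move=> y _; apply/aeW => r _; exact: normr_ray_exp_im_pihalf.
Qed.

Lemma integrable_expRN_halfline (s : R) : 0 < s ->
  mu.-integrable `]0, +oo[ (EFin \o (fun x => expR (- (s * x)))).
Proof.
move=> s0; apply: eq_integrable (integrable_powR_expR (lexx 0) s0) => // x _.
by rewrite /= powRr0 mul1r.
Qed.

Lemma cvg_expRN_mul_nat0 (s : R) : 0 < s -> expR (- (s * n.+2%:R)) @[n --> \oo] --> (0 : R).
Proof.
move=> s0; have := cvg_mul_expR_powRy ltr01 s0 1.
apply: cvgn0_le => n; rewrite ger0_norm ?expR_ge0// mul1r powRr1// ler_peMl ?expR_ge0//.
by rewrite (ler_nat _ 1).
Qed.

Lemma continuous_laplace_cos (s r p : R) :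
  continuous (fun x : R => expR (- (s * x)) * cos (x * r - p)).
Proof.
move=> x; apply: differentiable_continuous; apply/derivable1_diffP.
by apply: ex_derive.
Qed.

Lemma integrable_laplace_cos (s r p : R) : 0 < s ->
  mu.-integrable `]0, +oo[ (EFin \o (fun x => expR (- (s * x)) * cos (x * r - p))).
Proof.
move=> s0; apply: (le_integrable _ _ _ (integrable_expRN_halfline s0)) => //.
  apply/measurable_EFinP; apply: continuous_measurable_halfline => x _.
  exact: continuous_laplace_cos.
by move=> x _; rewrite /= lee_fin normrM ler_piMr// cos_max.
Qed.

Lemma laplace_cos (s r p : R) : 0 < s ->
  \int[mu]_(x in `]0, +oo[) (expR (- (s * x)) * cos (x * r - p)) =
  (s * cos p + r * sin p) / (s ^+ 2 + r ^+ 2).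
Proof.
move=> s0; have n0 : s ^+ 2 + r ^+ 2 != 0.
  by rewrite lt0r_neq0// ltr_pwDl ?exprn_gt0// sqr_ge0.
pose F (x : R) : R := expR (- (s * x)) *
  (r * sin (x * r - p) - s * cos (x * r - p)) / (s ^+ 2 + r ^+ 2).
have dF (x : R) : is_derive x 1 F (expR (- (s * x)) * cos (x * r - p)).
  by apply: is_derive_eq; rewrite /GRing.scale/=; field.
have cf := @continuous_laplace_cos s r p.
have cF (x : R) : {for x, continuous F}.
  by apply: differentiable_continuous; apply/derivable1_diffP; have [] := dF x.
rewrite (@Rintegral_FTC0y _ _ F (F 0) 0).
- by rewrite sub0r /F mul0r sub0r sinN cosN mulr0 oppr0 expR0; field.
- by move=> x _; exact: cf.
- exact: integrable_laplace_cos.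
- apply: continuous_cvg; first exact: cF.
  have := @cvg_harmonic R; rewrite -(cvg_shiftS (@harmonic R)).
  exact.
- have : expR (- (s * n.+2%:R)) * ((`|r| + `|s|) / (s ^+ 2 + r ^+ 2)) @[n --> \oo] -->
      (0 : R).
    rewrite -[X in _ --> X](mul0r ((`|r| + `|s|) / (s ^+ 2 + r ^+ 2))).
    by apply: cvgMl; exact: cvg_expRN_mul_nat0.
  apply: cvgn0_le => n; rewrite /F -mulrA normrM ger0_norm ?expR_ge0//.
  rewrite ler_pM2l ?expR_gt0// normrM normfV [X in _ / X]ger0_norm ?addr_ge0 ?sqr_ge0//.
  rewrite ler_wpM2r ?invr_ge0 ?addr_ge0 ?sqr_ge0//.
  rewrite -[X in _ <= X + _]mulr1 -[X in _ <= _ + X]mulr1.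
  by apply: normB_le; apply: normM_le; rewrite ?sin_max ?cos_max.
Qed.

Lemma ray_res_im_pihalf (s r : R) : ray_res_im a t s r (pi / 2) =
  expR (- (kappa * r `^ a)) *
  ((s * cos (phase r) + r * sin (phase r)) / (s ^+ 2 + r ^+ 2)).
Proof.
rewrite /ray_res_im sinB cos_pihalf sin_pihalf !(mulr0, mul0r, subr0, mulr1, mul1r).
by rewrite /phase -mulrA (mulrAC t (r `^ a)).
Qed.

Lemma integrable_laplace_stable_wave (s : R) : 0 < s ->
  mu.-integrable `]0, +oo[ (EFin \o (fun x => expR (- (s * x)) * stable_wave x)).
Proof.
move=> s0; pose M := \int[mu]_(r in `]0, +oo[) expR (- (kappa * r `^ a)).
apply: (le_integrable _ _ _ (integrableZl _ M (integrable_expRN_halfline s0))) => //.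
  apply/measurable_EFinP; apply: continuous_measurable_halfline => x _.
  by apply: cvgM; [exact: continuous_expRN|exact: continuous_stable_wave].
move=> x _; rewrite /= lee_fin !normrM mulrC ler_wpM2r//.
by rewrite (le_trans (normr_stable_wave_le x))// ler_norm.
Qed.

(** By Fubini's theorem the integration over [x] can be done first, and by
    [laplace_cos] it gives the integrand with denominator [s - z] on the
    imaginary axis, [s^2 + r^2] being [|s - i r|^2]. The integrand is
    dominated by the product of [p] and [q]. *)
Lemma laplace_stable_wave (s : R) : 0 < s ->
  \int[mu]_(x in `]0, +oo[) (expR (- (s * x)) * stable_wave x) =
  \int[mu]_(r in `]0, +oo[) ray_res_im a t s r (pi / 2).
Proof.
move=> s0; pose I : set R := `]0, +oo[%classic.
have mI : measurable (I : set (measurableTypeR R)) by exact: measurable_itv.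
pose p := (fun x : R => expR (- (s * x))) \_ I.
pose q := (fun r : R => expR (- (kappa * r `^ a))) \_ I.
have ip : mu.-integrable setT (EFin \o p).
  have /(integrable_mkcond _ mI) := integrable_expRN_halfline s0.
  by rewrite restrict_EFin.
have iq : mu.-integrable setT (EFin \o q).
  have /(integrable_mkcond _ mI) := integrable_expR_kappa.
  by rewrite restrict_EFin.
have mp : measurable_fun setT p by have /integrableP[/measurable_EFinP] := ip.
have mq : measurable_fun setT q by have /integrableP[/measurable_EFinP] := iq.
have p0 x : 0 <= p x by rewrite /p patchE; case: ifP => // _; exact: expR_ge0.
have q0 x : 0 <= q x by rewrite /q patchE; case: ifP => // _; exact: expR_ge0.
pose pq (z : R * R) : R := p z.1 * q z.2.
have mpq : measurable_fun setT pq.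
  by apply: measurable_funM; [exact: measurableT_comp mp measurable_fst|
                              exact: measurableT_comp mq measurable_snd].
have ipq : (mu \x mu)%E.-integrable setT (EFin \o pq).
  apply/integrable12ltyP; first exact/measurable_EFinP.
  have inner x : (\int[mu]_y `|(EFin \o pq) (x, y)| =
      (p x)%:E * \int[mu]_y (q y)%:E)%E.
    rewrite -ge0_integralZl_EFin//;
      [|by move=> y _; rewrite lee_fin|exact/measurable_EFinP].
    by apply: eq_integral => y _; rewrite /pq /= ger0_norm ?mulr_ge0// EFinM.
  under eq_integral do rewrite inner.
  rewrite ge0_integralZr//; [|exact/measurable_EFinP|by move=> x _; rewrite lee_fin|
    by apply: integral_ge0 => y _; rewrite lee_fin].
  by rewrite -(fineK (integrable_fin_num measurableT ip))
    -(fineK (integrable_fin_num measurableT iq)) -EFinM ltry.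
pose f (z : R * R) : R := p z.1 * (q z.2 * cos (z.1 * z.2 - phase z.2)).
have mf : measurable_fun setT f.
  apply: measurable_funM; first exact: measurableT_comp mp measurable_fst.
  apply: measurable_funM; first exact: measurableT_comp mq measurable_snd.
  apply: measurableT_comp; first exact: (continuous_measurable_fun (@continuous_cos R)).
  apply: measurable_funB; first exact: measurable_funM.
  have mphase : measurable_fun setT phase.
    by apply: measurable_funM => //; apply: measurable_funM => //; exact: measurable_powR.
  exact: measurableT_comp mphase measurable_snd.
have intf : (mu \x mu)%E.-integrable setT (EFin \o f).
  apply: le_integrable ipq => //; first exact/measurable_EFinP.
  move=> z _; rewrite /= lee_fin /f /pq !normrM ler_wpM2l// ler_piMr// cos_max//.
have Ex : (\int[mu]_x \int[mu]_y (EFin \o f) (x, y) =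
    \int[mu]_(x in I) (expR (- (s * x)) * stable_wave x)%:E)%E.
  rewrite [RHS]integral_mkcond; apply: eq_integral => x _; rewrite patchE.
  case: ifP => xI; last first.
    by rewrite integral0_eq// => y _; rewrite /= /f /p patchE /= xI mul0r.
  rewrite EFinM /stable_wave /Rintegral fineK; last first.
    by apply: integrable_fin_num => //; exact: integrable_ray_exp_im_pihalf.
  rewrite -integralZl//; last exact: integrable_ray_exp_im_pihalf.
  rewrite [RHS]integral_mkcond; apply: eq_integral => y _.
  rewrite patchE /= /f /p /q !patchE /= xI; case: ifP => _; last by rewrite mul0r mulr0.
  by rewrite -EFinM ray_exp_im_pihalf.
have Er : (\int[mu]_r \int[mu]_x (EFin \o f) (x, r) =
    \int[mu]_(r in I) (ray_res_im a t s r (pi / 2))%:E)%E.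
  rewrite [RHS]integral_mkcond; apply: eq_integral => r _; rewrite patchE.
  case: ifP => rI; last first.
    by rewrite integral0_eq// => x _; rewrite /= /f /q patchE /= rI mul0r mulr0.
  have il := integrable_laplace_cos r (phase r) s0.
  rewrite ray_res_im_pihalf EFinM -(laplace_cos r (phase r) s0) /Rintegral fineK; last first.
    exact: integrable_fin_num.
  rewrite -integralZl// [RHS]integral_mkcond; apply: eq_integral => x _.
  rewrite patchE /= /f /p /q !patchE /= rI; case: ifP => _; last by rewrite mul0r.
  by rewrite -EFinM; congr EFin; ring.
by rewrite /Rintegral -Ex -Er (Fubini intf).
Qed.

Lemma laplace_stable_density (s : R) : 0 < s ->
  \int[mu]_(x in `]0, +oo[) (expR (- (s * x)) * (pi^-1 * stable_wave x)) =
  expR (- (t * s `^ a)).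
Proof.
move=> s0; have pi0 : pi != 0 :> R by rewrite lt0r_neq0// pi_gt0.
transitivity (pi^-1 * \int[mu]_(x in `]0, +oo[) (expR (- (s * x)) * stable_wave x)).
  rewrite -RintegralZl//; last exact: integrable_laplace_stable_wave.
  by apply: eq_Rintegral => x _; ring.
by rewrite laplace_stable_wave// integral_ray_res_pihalf// mulrCA mulVf// mulr1.
Qed.

End stable_wave.

(** * Inversion of Laplace transforms *)

Section laplace_inversion.
Context d (Y : measurableType d) (R : realType) (nu : {measure set Y -> \bar R}).
Variables (D : set Y) (w Z : Y -> R).
Hypotheses (mD : measurable D) (mZ : measurable_fun D Z).
Hypothesis Z0 : forall y, D y -> 0 <= Z y.
Hypothesis iw : nu.-integrable D (EFin \o w).

Let mw : measurable_fun D w.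
Proof. by have /integrableP[/measurable_EFinP] := iw. Qed.

Let integrable_mul_w (f : Y -> R) (K : R) : measurable_fun D f ->
  (forall y, D y -> `|f y| <= K) -> nu.-integrable D (EFin \o (fun y => f y * w y)).
Proof.
move=> mf fK; apply: (le_integrable _ _ _ (integrableZl _ K iw)) => //.
  by apply/measurable_EFinP; exact: measurable_funM.
by move=> y Dy; rewrite /= lee_fin !normrM ler_wpM2r// (le_trans (fK _ Dy))// ler_norm.
Qed.

Let mexp (s : R) : measurable_fun D (fun y => expR (- (s * Z y))).
Proof. by apply: measurableT_comp => //; apply: measurableT_comp => //; exact: measurable_funM. Qed.

Lemma integrable_laplace (s : R) : 0 <= s ->
  nu.-integrable D (EFin \o (fun y => expR (- (s * Z y)) * w y)).
Proof.
move=> s0; apply: (@integrable_mul_w _ 1) => // y Dy.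
by rewrite ger0_norm ?expR_ge0// -expR0 ler_expR oppr_le0 mulr_ge0 ?Z0.
Qed.

(* The values of [Z] are seen only through [e^(- s Z)]; the powers of the latter
   are again exponentials [e^(- k s Z)], so the exponential of
   [Phi c s = - c e^(- s Z)] has a series that involves Laplace transforms
   only. *)
Let Phi (c s : R) (y : Y) : R := - (c * expR (- (s * Z y))).

Let mPhi c s : measurable_fun D (Phi c s).
Proof. by apply: measurableT_comp => //; exact: measurable_funM. Qed.

Let Phi_le (c s : R) y : 0 <= c -> 0 <= s -> D y -> `|Phi c s y| <= c.
Proof.
move=> c0 s0 Dy; rewrite normrN ger0_norm ?mulr_ge0 ?expR_ge0//.
by rewrite ler_piMr// -expR0 ler_expR oppr_le0 mulr_ge0 ?Z0.
Qed.

Let mseries c s n : measurable_fun D (fun y => series (exp_coeff (Phi c s y)) n).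
Proof.
apply: measurable_sum => k; apply: measurable_funM => //.
exact: measurable_funX.
Qed.

Let series_le c s n y : 0 <= c -> 0 <= s -> D y ->
  `|series (exp_coeff (Phi c s y)) n| <= expR c.
Proof.
move=> c0 s0 Dy; apply: (@le_trans _ _ (series (exp_coeff c) n)).
  rewrite (le_trans (ler_norm_sum _ _ _))//; apply: ler_sum => k _.
  rewrite /exp_coeff/= normrM normrX normfV normr_nat ler_wpM2r ?invr_ge0//.
  by rewrite lerXn2r ?nnegrE// Phi_le.
apply: nondecreasing_cvgn_le; last exact: is_cvg_series_exp_coeff.
by apply: nondecreasing_series => k _ _; exact: exp_coeff_ge0.
Qed.

Let Rintegral_series c s n : 0 <= c -> 0 <= s ->
  \int[nu]_(y in D) (series (exp_coeff (Phi c s y)) n * w y) =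
  series (fun k => (- c) ^+ k / k`!%:R *
    \int[nu]_(y in D) (expR (- (k%:R * s * Z y)) * w y)) n.
Proof.
move=> c0 s0; elim: n => [|n ih].
  rewrite /series/= big_geq// (_ : (fun y => _) = cst 0) ?Rintegral_cst ?mul0r//.
  by apply/funext => y; rewrite big_geq// mul0r.
have ns0 : 0 <= n%:R * s by rewrite mulr_ge0.
rewrite seriesSr -ih -RintegralZl//; last exact: integrable_laplace.
rewrite -RintegralD//.
- apply: eq_Rintegral => y _; rewrite seriesSr mulrDl; congr (_ + _).
  rewrite /exp_coeff/= /Phi -mulNr exprMn -expRM_natl.
  by rewrite [n%:R * - _](_ : _ = - (n%:R * s * Z y)); ring.
- by apply: (@integrable_mul_w _ (expR c)) => // y Dy; exact: series_le.
- have := integrableZl mD ((- c) ^+ n / n`!%:R) (integrable_laplace ns0).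
  by apply: eq_integrable => // y _.
Qed.

Lemma cvg_laplace_series (c s : R) : 0 <= c -> 0 <= s ->
  series (fun k => (- c) ^+ k / k`!%:R *
    \int[nu]_(y in D) (expR (- (k%:R * s * Z y)) * w y)) @ \oo -->
  \int[nu]_(y in D) (expR (- (c * expR (- (s * Z y)))) * w y).
Proof.
move=> c0 s0; rewrite (_ : series _ = (fun n =>
    \int[nu]_(y in D) (series (exp_coeff (Phi c s y)) n * w y))); last first.
  by apply/funext => n; rewrite Rintegral_series.
have mE : measurable_fun D (fun y => expR (Phi c s y)) by exact: measurableT_comp.
have E1 y : D y -> `|expR (Phi c s y)| <= 1.
  move=> Dy; rewrite ger0_norm ?expR_ge0// -expR0 ler_expR oppr_le0.
  by rewrite mulr_ge0 ?expR_ge0.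
apply: fine_cvg; rewrite fineK; last first.
  by apply: integrable_fin_num => //; exact: integrable_mul_w E1.
apply: (@dominated_cvg _ _ _ nu _ mD _ _ (fun y => (expR c)%:E * `|(w y)%:E|)%E).
- by move=> n; apply/measurable_EFinP; exact: measurable_funM.
- move=> y Dy; apply: cvg_EFin; first exact: nearW.
  by apply: cvgMl; exact: is_cvg_series_exp_coeff.
- by [].
- by apply: integrableZl => //; exact: integrable_abse iw.
- move=> n y Dy; rewrite /= -EFinM lee_fin normrM ler_wpM2r//.
  exact: series_le.
Qed.

(** For an integer [m], the number
    [m e^(m r) e^(- m Z) = m e^(m (r - Z))] tends to 0 if [Z > r] and to infinity
    if [Z <= r]; the first factor [m] settles the case [Z = r]. So the
    exponential of its opposite tends to the indicator of [Z > r]. *)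
Lemma cvg_laplace_tail (r : R) :
  \int[nu]_(y in D) (expR (- (n.+2%:R * expR (n.+2%:R * r) *
    expR (- (n.+2%:R * Z y)))) * w y) @[n --> \oo] -->
  \int[nu]_(y in D `&` Z @^-1` `]r, +oo[) w y.
Proof.
set E := D `&` _.
have mE : measurable E by apply: mZ.
have DE : E = D `&` E by rewrite /E setIA setIid.
have iE : nu.-integrable D (EFin \o (w \_ E)).
  rewrite -restrict_EFin; apply/(integrable_restrict _ _ _ _).1 => //.
  by apply: integrableS iw => //; exact: measurableI.
rewrite [X in _ --> X](_ : _ = \int[nu]_(y in D) (w \_ E) y); last first.
  by rewrite -Rintegral_mkcondr -DE.
apply: fine_cvg; rewrite fineK; last exact: integrable_fin_num.
apply: (@dominated_cvg _ _ _ nu _ mD _ _ (fun y => `|(w y)%:E|)%E).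
- move=> n; apply/measurable_EFinP; apply: measurable_funM => //.
  exact: measurableT_comp (mPhi _ _).
- move=> y Dy; apply: cvg_EFin; first exact: nearW.
  have eE n : n.+2%:R * expR (n.+2%:R * r) * expR (- (n.+2%:R * Z y)) =
      n.+2%:R * expR (- ((Z y - r) * n.+2%:R)).
    by rewrite -mulrA -expRD; congr (_ * expR _); ring.
  have [rZ|Zr] := ltP r (Z y).
    rewrite patchE ifT; last by rewrite inE; split => //=; rewrite in_itv/= rZ.
    rewrite -[X in _ --> X]mul1r; apply: cvgMl.
    rewrite (funext (fun n => congr1 (fun z => expR (- z)) (eE n))).
    rewrite -[X in _ --> X](expR0 R) -oppr0.
    apply: continuous_cvg; first exact: continuous_expR.
    apply: cvgN; rewrite -subr_gt0 in rZ.
    have := cvg_mul_expR_powRy ltr01 rZ 1.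
    by apply: cvgn0_le => n; rewrite mul1r powRr1// ger0_norm// mulr_ge0// expR_ge0.
  rewrite patchE ifF; last first.
    by apply/negP; rewrite inE => -[_] /=; rewrite in_itv/= andbT ltNge Zr.
  rewrite -[X in _ --> X](mul0r (w y)); apply: cvgMl.
  under eq_cvg do rewrite eE.
  have := @cvg_expRN_mul_nat0 R 1 ltr01; apply: cvgn0_le => n.
  rewrite mul1r ger0_norm ?expR_ge0// ler_expR lerN2 ler_peMr//.
  by rewrite -expR0 ler_expR -mulNr mulr_ge0// opprB subr_ge0.
- by [].
- exact: integrable_abse iw.
- move=> n y Dy; rewrite /= lee_fin normrM ler_piMl// ger0_norm ?expR_ge0//.
Qed.

End laplace_inversion.

(** Uniqueness for Laplace transforms of signed measures [w nu] carried by
    [Z >= 0]: by [cvg_laplace_series] and [cvg_laplace_tail] the tails are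
    limits of limits of combinations of values of the transform. The two sides
    may live on different spaces, here a probability space and the half
    line, and the second weight is not known beforehand to be nonnegative. *)
Lemma laplace_tail_eq d1 d2 (Y1 : measurableType d1) (Y2 : measurableType d2)
    (R : realType) (nu1 : {measure set Y1 -> \bar R}) (nu2 : {measure set Y2 -> \bar R})
    (D1 : set Y1) (D2 : set Y2) (w1 Z1 : Y1 -> R) (w2 Z2 : Y2 -> R) :
  measurable D1 -> measurable_fun D1 Z1 -> (forall y, D1 y -> 0 <= Z1 y) ->
  nu1.-integrable D1 (EFin \o w1) ->
  measurable D2 -> measurable_fun D2 Z2 -> (forall y, D2 y -> 0 <= Z2 y) ->
  nu2.-integrable D2 (EFin \o w2) ->
  (forall s : R, 0 <= s -> \int[nu1]_(y in D1) (expR (- (s * Z1 y)) * w1 y) =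
    \int[nu2]_(y in D2) (expR (- (s * Z2 y)) * w2 y)) ->
  forall r : R, \int[nu1]_(y in D1 `&` Z1 @^-1` `]r, +oo[) w1 y =
    \int[nu2]_(y in D2 `&` Z2 @^-1` `]r, +oo[) w2 y.
Proof.
move=> mD1 mZ1 Z10 iw1 mD2 mZ2 Z20 iw2 L r.
have c1 := @cvg_laplace_tail _ _ _ _ _ _ _ mD1 mZ1 iw1 r.
have c2 := @cvg_laplace_tail _ _ _ _ _ _ _ mD2 mZ2 iw2 r.
rewrite -(cvg_lim (@Rhausdorff R) c1) -(cvg_lim (@Rhausdorff R) c2).
congr (limn _); apply/funext => n.
have c0 : 0 <= n.+2%:R * expR (n.+2%:R * r) by rewrite mulr_ge0 ?expR_ge0.
have n0 : 0 <= n.+2%:R :> R by [].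
have s1 := @cvg_laplace_series _ _ _ _ _ _ _ mD1 mZ1 Z10 iw1 _ _ c0 n0.
have s2 := @cvg_laplace_series _ _ _ _ _ _ _ mD2 mZ2 Z20 iw2 _ _ c0 n0.
rewrite -(cvg_lim (@Rhausdorff R) s1) -(cvg_lim (@Rhausdorff R) s2).
congr (limn (series _)); apply/funext => k.
by rewrite L// mulr_ge0.
Qed.

(** * Densities from Laplace transforms *)

Section density_measure.
Context {R : realType}.
Notation mu := (@lebesgue_measure R).

(** The two conditions are arguments, so that the structure of a measure can be
    attached to this set function. *)
Definition density_measure (h : R -> R) of measurable_fun setT h & (forall x, 0 <= h x) :
  set R -> \bar R := fun A => (\int[mu]_(x in A) (h x)%:E)%E.

Section instance.
Variables (h : R -> R) (mh : measurable_fun setT h) (h0 : forall x, 0 <= h x).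

Let density0 : density_measure mh h0 set0 = 0%E.
Proof. exact: integral_set0. Qed.

Let density_ge0 A : (0 <= density_measure mh h0 A)%E.
Proof. by apply: integral_ge0 => x _; rewrite lee_fin. Qed.

Let density_sigma_additive : semi_sigma_additive (density_measure mh h0).
Proof.
move=> /= F mF tF mUF; rewrite /density_measure; apply: cvg_toP.
  apply: ereal_nondecreasing_is_cvgn => m n mn.
  by apply: lee_sum_nneg_natr => // k _ _; apply: integral_ge0 => /= x _; rewrite lee_fin.
rewrite ge0_integral_bigcup//=.
- exact/measurable_EFinP/measurable_funTS.
- by move=> x _; rewrite lee_fin.
Qed.

HB.instance Definition _ := isMeasure.Build _ _ _ (density_measure mh h0)
  density0 density_ge0 density_sigma_additive.

End instance.
End density_measure.

Section density_of_laplace.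
Context d (T : measurableType d) (R : realType) (P : probability T R).
Notation mu := (@lebesgue_measure R).
Variables (X : {RV P >-> R}) (H : R -> R).
Hypothesis cH : continuous H.
Hypothesis iH : mu.-integrable `]0, +oo[ (EFin \o H).
Hypothesis X0 : {ae P, forall w, 0 <= X w}.
Hypothesis LX : forall s, 0 <= s -> ('E_P[fun w => expR (- (s * X w))] =
  (\int[mu]_(x in `]0, +oo[) (expR (- (s * x)) * H x))%:E)%E.

Let h (x : R) : R := if 0 < x then H x else 0.

Let mX : measurable_fun setT X := measurable_funPT X.

(* The comparison takes place on [0 <= X], an event of full probability. *)
Let tail (r : R) : P (X @^-1` `]r, +oo[) =
  (\int[mu]_(x in `]0, +oo[ `&` `]r, +oo[) H x)%:E.
Proof.
pose D1 : set T := X @^-1` `[0, +oo[.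
have mpre (A : set (measurableTypeR R)) : measurable A -> measurable (X @^-1` A).
  by move=> mA; rewrite -[X @^-1` A]setTI; exact: mX.
have mD1 : measurable D1 by apply: mpre; exact: measurable_itv.
have ND1 : P (~` D1) = 0%E.
  have [N [mN N0 sub]] := X0.
  apply/eqP; rewrite -measure_le0 -N0; apply: le_measure; rewrite ?inE//.
    exact: measurableC.
  apply: subset_trans sub => w nD1 /= Xw; apply: nD1.
  by rewrite /D1/= in_itv/= andbT.
have i1 : P.-integrable D1 (EFin \o cst 1).
  by apply: finite_measure_integrable_cst.
have tails := @laplace_tail_eq _ _ _ _ R P mu D1 `]0, +oo[ (cst 1) X H id
  mD1 _ _ i1 _ _ _ iH.
have {tails} : \int[P]_(y in D1 `&` X @^-1` `]r, +oo[) cst 1 y =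
    \int[mu]_(y in `]0, +oo[ `&` id @^-1` `]r, +oo[) H y.
  apply: tails => //.
  - exact: measurable_funTS.
  - by move=> w; rewrite /D1/= in_itv/= andbT.
  - by move=> x; rewrite /= in_itv/= andbT => /ltW.
  - move=> s s0; have := LX s0; rewrite unlock.
    rewrite (@ge0_negligible_integral _ _ _ _ _ (~` D1)) => //.
    + rewrite setTD setCK => E.
      by rewrite {1}/Rintegral; under eq_integral do rewrite mulr1; rewrite E.
    + exact: measurableC.
    + apply/measurable_EFinP; apply: measurableT_comp => //.
      by apply: measurableT_comp => //; exact: measurable_funM.
have mr := mpre `]r, +oo[%classic (measurable_itv _).
rewrite Rintegral_cst; last exact: measurableI.
rewrite mul1r preimage_id => <-; rewrite fineK; last first.
  by apply: fin_num_measure; exact: measurableI.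
rewrite -[X in P X = _]setTI -(setUv D1) setIUl measureU//.
- rewrite [X in (_ + X)%E](_ : _ = 0%E) ?adde0//.
  apply/eqP; rewrite -measure_le0 -ND1; apply: le_measure; rewrite ?inE//.
    by apply: measurableI => //; exact: measurableC.
  exact: measurableC.
- exact: measurableI.
- by apply: measurableI => //; exact: measurableC.
- by rewrite setIACA setICr set0I.
Qed.

(* If [H] were negative at [x], it would be so between [x] and some [b > x]
   by continuity, and the tail of [X] would increase from [x] to [b]. *)
Let H_ge0 (x : R) : 0 < x -> 0 <= H x.
Proof.
move=> x0; rewrite leNgt; apply/negP => Hx.
have H2 : H x / 2 < 0 by rewrite pmulr_llt0.
have : \forall y \near x, H y < H x / 2.
  have Hx2 : H x < H x / 2 by lra.
  exact: (cvgr_lt (H x) (@cH x) _ Hx2).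
move=> /nbhs_ballP[e /= e0 He]; pose b := x + e / 2.
have xb : x < b by rewrite /b ltrDl divr_gt0.
have pos r : 0 < r -> (`]0, +oo[ `&` `]r, +oo[ = `]r, +oo[ :> set R)%classic.
  move=> r0; apply/setIidr => y; rewrite /= !in_itv/= !andbT.
  exact: lt_trans.
have split : (`]x, +oo[ = `]x, b] `|` `]b, +oo[ :> set R)%classic.
  by rewrite -itv_bndbnd_setU// bnd_simp ltW.
have ix : mu.-integrable `]x, +oo[ (EFin \o H).
  apply: integrableS iH => //; move=> y; rewrite /= !in_itv/= !andbT.
  exact: lt_trans.
have ixb : mu.-integrable `]x, b] (EFin \o H).
  by apply: integrableS ix => //; rewrite split; exact: subsetUl.
have : \int[mu]_(y in `]x, b]) H y <= \int[mu]_(y in `]x, b]) (H x / 2).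
  apply: le_Rintegral => //.
    apply: measurable_bounded_integrable => //; last exact: bounded_cst.
    by rewrite /= lebesgue_measure_itv/= lte_fin xb ltry.
  move=> y; rewrite /= in_itv/= => /andP[xy yb]; apply/ltW/He.
  by rewrite /ball/= ltr_norml; rewrite /b in yb; apply/andP; split; lra.
rewrite Rintegral_cst//= lebesgue_measure_itv/= lte_fin xb -EFinD/=.
apply/negP; rewrite -ltNge (@lt_le_trans _ _ 0)//.
  by rewrite nmulr_rlt0// subr_gt0.
have := tail x; have := tail b.
rewrite (pos _ x0) (pos _ (lt_trans x0 xb)) split Rintegral_setU//; last 2 first.
  by rewrite -split.
  by apply/disj_setPS => y [] /=; rewrite !in_itv/= andbT => /andP[_ yb]; rewrite ltNge yb.
move=> Pb Px.
have : (P (X @^-1` `]b, +oo[) <= P (X @^-1` `]x, +oo[))%E.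
  apply: le_measure; rewrite ?inE.
  - by rewrite -[X in measurable X]setTI; exact: mX (measurable_itv _).
  - by rewrite -[X in measurable X]setTI; exact: mX (measurable_itv _).
  - by move=> w; rewrite /= !in_itv/= !andbT; exact: lt_trans.
by rewrite Pb split Px lee_fin lerDr.
Qed.

(** The candidate density is not assumed to be nonnegative: this follows from
    the equality of the tails. The open right rays are stable under
    intersection and generate the Borel sets, so that the distribution of [X]
    is determined by its tails. *)
Lemma has_density_of_laplace : has_density X h.
Proof.
have hE : h = H \_ `]0, +oo[.
  apply/funext => x; rewrite patchE /h.
  case: ifPn => x0; first by rewrite ifT// inE/= in_itv/= x0.
  by rewrite ifF//; apply/negP; rewrite inE/= in_itv/= andbT; exact/negP.
have mI : measurable (`]0, +oo[%classic : set (measurableTypeR R)).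
  exact: measurable_itv.
have mh : measurable_fun setT h.
  rewrite hE; apply/(measurable_restrictT _ mI).
  by apply: continuous_measurable_halfline => x _; exact: cH.
have h0 x : 0 <= h x by rewrite /h; case: ifPn => // /H_ge0.
split => //.
move=> A mA.
rewrite -[RHS]/(density_measure mh h0 A).
apply: (measure_unique (@RGenOInfty.G R) (fun k => `](- k%:R), +oo[%classic)) => //.
- exact: RGenOInfty.measurableE.
- move=> _ _ [x ->] [y ->]; exists (Num.max x y).
  apply/seteqP; split => z; rewrite /= !in_itv/= !andbT gt_max.
    by move=> [-> ->].
  by move=> /andP[].
- by move=> k; exists (- k%:R).
- rewrite -subTset => z _; exists (Num.truncn `|z|).+1 => //=.
  rewrite in_itv/= andbT ltrNl (le_lt_trans (ler_norm _))// normrN.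
  by rewrite truncnS_gt.
- move=> _ [r ->]; rewrite -[LHS]/(P (X @^-1` `]r, +oo[)) tail.
  rewrite -[RHS]/(\int[mu]_(x in `]r, +oo[) (h x)%:E)%E.
  have mr : measurable (`]r, +oo[%classic : set (measurableTypeR R)).
    exact: measurable_itv.
  rewrite /Rintegral fineK; last first.
    apply: integrable_fin_num; first exact: measurableI.
    by apply: integrableS iH => //; exact: measurableI.
  rewrite setIC integral_mkcondr; apply: eq_integral => z _.
  by rewrite hE !patchE; case: ifP.
- by move=> k; rewrite (le_lt_trans (probability_le1 _ _)) ?ltry//.
Qed.

End density_of_laplace.

(** * The tempered stable density *)

Theorem proposition4p1 (R : realType) (d : measure_display)
    (T : measurableType d) (P : probability T R) (alpha lambda t : R)
    (D : R -> {RV P >-> R})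
    (alpha_gt0 : 0 < alpha) (alpha_lt1 : alpha < 1)
    (lambda_gt0 : 0 < lambda) (t_gt0 : 0 < t)
    (HD : tempered_stable_subordinator alpha lambda D) :
  (forall x : R, 0 < x -> cvgn (series (tss_term alpha x t))) /\
  has_density (D t) (fun x => tss_density alpha lambda x t).
Proof.
split=> [x x0|].
  exact: (cvgP _ (cvg_tss_series alpha_gt0 alpha_lt1 t_gt0 x0)).
pose H (x : R) := expR (- (lambda * x) + t * lambda `^ alpha) *
  (pi^-1 * stable_wave alpha t x).
rewrite (_ : (fun x => _) = fun x => if 0 < x then H x else 0); last first.
  apply/funext => x; rewrite /tss_density; case: ifPn => // x0.
  congr (_ * _).
  exact: (cvg_lim (@Rhausdorff R) (cvg_tss_series alpha_gt0 alpha_lt1 t_gt0 x0)).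
(* Tempering shifts the Laplace variable by [lambda]. *)
have HE s x : expR (- (s * x)) * H x = expR (t * lambda `^ alpha) *
    (expR (- ((s + lambda) * x)) * (pi^-1 * stable_wave alpha t x)).
  rewrite /H !mulrA -!expRD; congr (expR _ * _ * _); ring.
have iL (s : R) : 0 <= s -> lebesgue_measure.-integrable `]0, +oo[
    (EFin \o fun x => expR (- ((s + lambda) * x)) * (pi^-1 * stable_wave alpha t x)).
  move=> s0; have sl : 0 < s + lambda by rewrite ltr_wpDl.
  have := integrableZl _ pi^-1 (integrable_laplace_stable_wave alpha_gt0 alpha_lt1 t_gt0 sl).
  move=> /(_ (measurable_itv _)); apply: eq_integrable => // x _.
  by rewrite /= -EFinM mulrCA.
apply: has_density_of_laplace.
- move=> x; apply: cvgM; last first.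
    by apply: cvgM; [exact: cvg_cst|exact: continuous_stable_wave].
  apply: continuous_comp; last exact: continuous_expR.
  apply: cvgD; last exact: cvg_cst.
  by apply: cvgN; apply: cvgM => //; exact: cvg_cst.
- have := integrableZl _ (expR (t * lambda `^ alpha)) (iL _ (lexx 0)).
  move=> /(_ (measurable_itv _)); apply: eq_integrable => // x _.
  by rewrite /= -EFinM -HE mul0r oppr0 expR0 mul1r.
(* Monotone paths that start at 0 are nonnegative. *)
- have subD := tss_subordinator HD.
  apply: filterS2 (levy_start (subordinator_levy subD))
    (subordinator_nondecreasing subD) => w D0 /(_ 0 t (lexx _) (ltW t_gt0)).
  by rewrite D0.
- move=> s s0; have sl : 0 < s + lambda by rewrite ltr_wpDl.
  have -> : \int[lebesgue_measure]_(x in `]0, +oo[) (expR (- (s * x)) * H x) =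
      expR (- (t * ((s + lambda) `^ alpha - lambda `^ alpha))).
    under eq_Rintegral do rewrite HE.
    rewrite RintegralZl//; last exact: iL.
    by rewrite laplace_stable_density// -expRD; congr expR; ring.
  (* The Laplace transform is prescribed for [0 < s] only; at 0 it is the total
     mass. *)
  have [->|s_neq0] := eqVneq s 0.
    rewrite add0r subrr mulr0 oppr0 expR0 -(expectation_cst P 1).
    by rewrite (_ : (fun w => _) = cst 1)//; apply/funext => w; rewrite mul0r oppr0 expR0.
  by apply: tss_laplace; rewrite ?(ltW t_gt0)// lt0r s_neq0.
Qed.
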